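(* Let $G$ be a finite simple graph that is embeddable in the torus or in the Klein bottle. Suppose that $G$ contains no cycle of length 3, no cycle of length 4, and no cycle of length 6, and that no two distinct cycles of length 5 in $G$ share an edge. Then $G$ is odd 5-choosable.
   Context: For a positive integer $k$, a $k$-list-assignment of a graph $G$ is a family $L=(L_v : v\in V(G))$ of sets with $|L_v|=k$ for every vertex $v$. An $L$-coloring is a function $f$ with $f(v)\in L_v$ for every $v$; it is proper if $f(u)\neq f(v)$ for every edge $uv$. A graph $G$ is odd $k$-choosable if for every $k$-list-assignment $L$ of $G$ there exists a proper $L$-coloring $f$ such that for every non-isolated vertex $v$, some color appears an odd number of times among the colors $f(u)$, $u\in N(v)$ (i.e., there is a color $c$ with $|\{u\in N(v): f(u)=c\}|$ odd). *)

(* Defs.v *)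
From HB Require Import structures.
From mathcomp Require Import all_boot all_order all_algebra.
From mathcomp Require Import generic_quotient finmap.
From mathcomp Require Import boolp classical_sets functions set_interval.
From mathcomp Require Import reals topology normedtype.

Set Implicit Arguments.
Unset Strict Implicit.
Unset Printing Implicit Defensive.

Import Order.TTheory GRing.Theory Num.Theory.
Import numFieldNormedType.Exports.

Local Open Scope ring_scope.
Local Open Scope classical_set_scope.
Local Open Scope quotient_scope.

Definition plane_sign (k : bool) (m : int) : int := if k then (-1) ^ m else 1.

(* The orbit relation on the plane of the group generated by
   (x, y) |-> (x, y + 1) and (x, y) |-> (x + 1, y) when k = false, or
   (x, y) |-> (x + 1, - y) when k = true.  Equivalently, opposite sides of the
   unit square are identified, the vertical ones with a flip if k = true. *)
Definition plane_orbit (R : realType) (k : bool) (p q : R * R) : Prop :=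
  exists m n : int,
    q.1 = p.1 + m%:~R /\ q.2 = (plane_sign k m)%:~R * p.2 + n%:~R.

Lemma plane_signD k m n : plane_sign k (m + n) = plane_sign k m * plane_sign k n.
Proof. by rewrite /plane_sign; case: k; rewrite ?mulr1// exprzDr ?unitrN1. Qed.

Section PlaneQuotient.
Variables (R : realType) (k : bool).

Let orbitb (p q : R * R) : bool := `[< plane_orbit k p q >].

Lemma orbitb_refl : reflexive orbitb.
Proof.
move=> p; apply/asboolP; exists 0, 0; rewrite !addr0; split=> //.
by rewrite /plane_sign; case: k; rewrite mul1r.
Qed.

Lemma orbitb_sym : symmetric orbitb.
Proof.
have imp p q : plane_orbit k p q -> plane_orbit k q p.
  move=> [m [n [e1 e2]]]; exists (- m), (- (plane_sign k (- m) * n)).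
  split; first by rewrite e1 mulrNz addrK.
  rewrite e2 mulrDr mulrA -intrM -plane_signD addNr mulrNz intrM addrK.
  by rewrite /plane_sign; case: k; rewrite mul1r.
by move=> p q; apply/asboolP/asboolP; apply: imp.
Qed.

Lemma orbitb_trans : transitive orbitb.
Proof.
move=> q p r /asboolP[m [n [e1 e2]]] /asboolP[m' [n' [e1' e2']]].
apply/asboolP; exists (m' + m), (plane_sign k m' * n + n').
split; first by rewrite e1' e1 -addrA -intrD [m + m']addrC.
by rewrite e2' e2 plane_signD intrD !intrM mulrDr mulrA addrA.
Qed.

Definition plane_equiv : equiv_rel (R * R)%type :=
  EquivRel orbitb orbitb_refl orbitb_sym orbitb_trans.

End PlaneQuotient.

Definition torus (R : realType) : topologicalType :=
  quotient_topology {eq_quot (plane_equiv R false)}.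

Definition klein_bottle (R : realType) : topologicalType :=
  quotient_topology {eq_quot (plane_equiv R true)}.

Definition is_arc (R : realType) (X : topologicalType) (A : set X) (x y : X) :=
  exists g : R -> X,
    [/\ {within `[0, 1], continuous g},
        {in `[0, 1]%R &, injective g},
        g 0 = x, g 1 = y & A = g @` `[0, 1]].

(* A finite simple graph is a symmetric irreflexive relation e on a finType;
   its edges are the pairs [set u; v] with e u v. *)
Definition embeddable (R : realType) (X : topologicalType) (V : finType)
    (e : rel V) : Prop :=
  exists (p : V -> X) (A : {set V} -> set X),
    [/\ injective p,
        forall u v, e u v -> is_arc R (A [set u; v]%SET) (p u) (p v),
        forall u v w, e u v -> A [set u; v]%SET (p w) -> w = u \/ w = v
      & forall u v x y, e u v -> e x y ->
          [set u; v]%SET != [set x; y]%SET ->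
          A [set u; v]%SET `&` A [set x; y]%SET `<=` range p].

(* For 3 <= k this is a k-cycle subgraph traversed from one of its vertices,
   each subgraph arising from several sequences c. *)
Definition is_cycle (V : finType) (e : rel V) (k : nat) (c : seq V) : Prop :=
  ucycle e c /\ size c = k.

Definition has_cycle (V : finType) (e : rel V) (k : nat) : Prop :=
  exists c : seq V, is_cycle e k c.

(* Two cycles are the same subgraph exactly when these edge sets agree. *)
Definition cycle_edges (V : finType) (c : seq V) : {set {set V}} :=
  [set [set x; next c x]%SET | x in c]%SET.

Definition list_assignment (V : finType) (C : choiceType) (k : nat)
    (L : V -> {fset C}) : Prop := forall v, #|` L v| = k.

Definition list_coloring (V : finType) (C : choiceType) (L : V -> {fset C})
    (f : V -> C) : Prop := forall v, f v \in L v.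

Definition proper (V : finType) (e : rel V) (C : choiceType) (f : V -> C) :
  Prop := forall u v, e u v -> f u <> f v.

Definition odd_at (V : finType) (e : rel V) (C : choiceType) (f : V -> C)
    (v : V) : Prop := exists c : C, odd #|[set u | e v u & f u == c]%SET|.

Definition odd_choosable (V : finType) (e : rel V) (k : nat) : Prop :=
  forall (C : choiceType) (L : V -> {fset C}), list_assignment k L ->
    exists f : V -> C,
      [/\ list_coloring L f, proper e f
        & forall v, (exists u, e v u) -> odd_at e f v].

(* Main.v *)
Require Import Defs.
From HB Require Import structures.
From mathcomp Require Import all_boot all_order all_algebra.
From mathcomp Require Import finmap zify ring lra.
From mathcomp Require Import reals.
From mathcomp Require boolp.

(* The embedded graph is a minor of a fine square grid on the torus or Klein bottle:
   the branch set of a vertex is a small square around it, enlarged by the grid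
   nodes near the incident edges oriented away from it.  The unit squares of the
   grid span, over F_2, a subspace of codimension at most 2 of its cycle space;
   summing squares across the unused edges gives a family of faces in the cycle
   space of G such that each edge lies on at most two of them and the span has
   codimension at most 2.  As nonzero even subgraphs have 5 or at least 7 edges, and
   the 5-cycles are edge-disjoint, counting edges of faces yields
   5 |E| <= 7 |V| + 2 c5, where c5 is the number of 5-cycles, except in a degenerate
   case with few vertices.

   In a counterexample with fewest edges, 2-vertices are pairwise nonadjacent and
   can be colored last.  They then take care of the oddness of their neighbors, so
   that deleting a vertex u of degree at least 3 together with its 2-neighbors shows
   that the degree of u plus its number of even neighbors without 2-neighbors is at
   least 5, unless u itself is even without 2-neighbors.  Discharging turns this
   into 5 |E| > 7 |V| + 2 c5. *)

Set Implicit Arguments.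
Unset Strict Implicit.
Unset Printing Implicit Defensive.
Import Order.TTheory GRing.Theory Num.Theory.

(** * Grids and minors *)

(** The arcs are arbitrary curves and nothing is known about the regions that they bound, so Euler's
    formula and the usual faces are not at hand. Passing to a grid needs only compactness. All
    topology is then contained in one dimension count: with as many squares as nodes and twice as
    many edges, the Euler characteristic is 0, so connectedness of the grid and of its dual bounds
    the first Betti number by 2. Over F_2 orientations disappear, and the torus and the Klein bottle
    are treated alike. Being a grid minor passes to subgraphs, so that the minimal counterexample
    involves no geometry. *)

Definition grid_adj (Y : finType) (E N : Y -> Y) : rel Y :=
  fun x y => [|| y == E x, y == N x, x == E y | x == N y].

Definition rel_in (Y : finType) (r : rel Y) (P : pred Y) : rel Y :=
  fun x y => [&& r x y, P x & P y].

(** Connectedness, in a form that suits linear algebra. For [E] and [N] it concerns the nodes, for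
    [T] and [N] the squares: in a grid the square [y] shares a side with [T y] and with [N y]. *)
Definition jointly_transitive (Y : finType) (f g : Y -> Y) :=
  forall P : pred Y, (forall y, P (f y) = P y) -> (forall y, P (g y) = P y) ->
  forall x y, P x = P y.

(* Edges of the grid join y to E y and to N y; the square y is bounded by
   the edges {y, E y}, {N y, E (N y)}, {y, N y} and {T y, N (T y)}. *)
Definition quad_grid (Y : finType) (E N T : Y -> Y) :=
  [/\ injective N, injective T, jointly_transitive E N, jointly_transitive T N
    & forall y, T y = E y /\ N (T y) = E (N y) \/
                T y = E (N y) /\ N (T y) = E y].

Definition grid_minor (V : finType) (e : rel V) :=
  exists (Y : finType) (E N T : Y -> Y) (br : V -> {set Y}),
  [/\ quad_grid E N T,
      forall u v x, x \in br u -> x \in br v -> u = v,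
      forall v x y, x \in br v -> y \in br v ->
        connect (rel_in (grid_adj E N) (mem (br v))) x y
    & forall u v, e u v -> exists x y,
        [/\ x \in br u, y \in br v & grid_adj E N x y]].

Lemma grid_adj_sym (Y : finType) (E N : Y -> Y) : symmetric (grid_adj E N).
Proof. by move=> x y; rewrite /grid_adj; do 2![case: eqP => _]; rewrite ?orbT ?orbF. Qed.

Lemma rel_in_sym (Y : finType) (r : rel Y) (P : pred Y) :
  symmetric r -> symmetric (rel_in r P).
Proof. by move=> rs x y; rewrite /rel_in rs [P x && _]andbC. Qed.

(** * Chains over F_2 *)

Section Chains.
Local Open Scope ring_scope.

Definition chain (T : finType) := {ffun T -> ('F_2)^o}.

Lemma F2_addrr (x : 'F_2) : x + x = 0.
Proof. by apply: addrr_pchar2; rewrite pchar_Fp. Qed.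

Lemma F2_eqP (x y : 'F_2) : x + y = 0 -> x = y.
Proof. by move=> xy; rewrite -[x]addr0 -(F2_addrr y) addrA xy add0r. Qed.

Lemma chain_addrr (T : finType) (c : chain T) : c + c = 0.
Proof. by apply/ffunP => x; rewrite !ffunE F2_addrr. Qed.

Definition delta (T : finType) (x : T) : chain T := [ffun y => (x == y)%:R].

Lemma chain_delta (T : finType) (c : chain T) : c = \sum_x c x *: delta x.
Proof.
apply/ffunP => y; rewrite sum_ffunE (bigD1 y)//= !ffunE eqxx [_ *: _]mulr1.
rewrite big1 ?addr0// => x xy; rewrite !ffunE (negPf xy); exact: mulr0.
Qed.

Lemma dim_chain (T : finType) : \dim {:chain T} = #|T|.
Proof. by rewrite dimvf /dim /= muln1. Qed.

(** The kernel of [f] on [B] lies in its kernel on [A], so [f] does not increase codimensions. *)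
Lemma dim_limg_sub (aT rT : vectType 'F_2) (f : 'Hom(aT, rT)) (A B : {vspace aT}) :
  (B <= A)%VS -> (\dim (f @: A) + \dim B <= \dim (f @: B) + \dim A)%N.
Proof.
move=> BA; have := dimvS (capvS BA (subvv (lker f))).
by have := limg_ker_dim f A; have := limg_ker_dim f B; lia.
Qed.

Lemma lker_linfun (aT rT : vectType 'F_2) (f : {linear aT -> rT}) v :
  (v \in lker (linfun f)) = (f v == 0).
Proof. by rewrite memv_ker lfunE. Qed.

End Chains.

(** * Cellular homology of the grid over F_2 *)

Section GridHomology.
Local Open Scope ring_scope.
Variables (Y : finType) (E N T : Y -> Y).
Hypothesis grid : quad_grid E N T.

(* (y, false) is the edge from y to E y and (y, true) the edge from y to N y. *)
Definition tgt (a : Y * bool) := if a.2 then N a.1 else E a.1.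

(* The edge a lies on the squares a.1 and opp_side a. *)
Definition opp_side (a : Y * bool) := if a.2 then finv T a.1 else finv N a.1.

Definition d1 (c : chain (Y * bool)%type) : chain Y :=
  [ffun x => \sum_a c a * ((a.1 == x)%:R + (tgt a == x)%:R)].

Definition d2 (g : chain Y) : chain (Y * bool)%type :=
  [ffun a => g a.1 + g (opp_side a)].

Lemma d1_is_linear : linear d1.
Proof.
move=> k c c'; apply/ffunP => x; rewrite !ffunE scaler_sumr -big_split /=.
by apply: eq_bigr => a _; rewrite !ffunE mulrDl -scalerAl.
Qed.
HB.instance Definition _ := GRing.isLinear.Build _ _ _ _ d1 d1_is_linear.

Lemma d2_is_linear : linear d2.
Proof.
by move=> k c c'; apply/ffunP => x; rewrite !ffunE scalerDr addrACA.
Qed.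
HB.instance Definition _ := GRing.isLinear.Build _ _ _ _ d2 d2_is_linear.

Lemma d1_delta a : d1 (delta a) = delta a.1 + delta (tgt a).
Proof.
apply/ffunP => x; rewrite !ffunE (bigD1 a)//= !ffunE eqxx mul1r.
by rewrite big1 ?addr0// => b ba; rewrite !ffunE eq_sym (negPf ba) mul0r.
Qed.

(** Exchanging the sums collects the four sides of each square. Every corner is an end of exactly
    two sides, so the ends cancel mod 2, whether or not the square is flipped. *)
Lemma d1_d2 g : d1 (d2 g) = 0.
Proof.
case: grid => injN injT _ _ sq; apply/ffunP => x; rewrite !ffunE.
pose phi a : 'F_2 := (a.1 == x)%:R + (tgt a == x)%:R.
transitivity (\sum_y (g y * (phi (y, false) + phi (N y, false) +
    (phi (y, true) + phi (T y, true)))) : 'F_2).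
  rewrite (eq_bigr (fun p => d2 g (p.1, p.2) * phi (p.1, p.2))); last by case.
  rewrite -(pair_bigA _ (fun y b => d2 g (y, b) * phi (y, b))) /=.
  under eq_bigr => y _ do rewrite big_bool /= !ffunE /=.
  rewrite big_split/=.
  (* [finv f] inverts an injection of a finite type, so reindexing moves the shift from the square
     to the edge. *)
  have shift (f : Y -> Y) (b : bool) : injective f ->
      \sum_y (g y + g (finv f y)) * phi (y, b) =
      \sum_y g y * (phi (y, b) + phi (f y, b)) :> 'F_2.
    move=> injf; under eq_bigr => y _ do rewrite mulrDl.
    rewrite big_split /=.
    rewrite [X in _ + X](reindex_inj injf) /= -big_split /=.
    by apply: eq_bigr => y _; rewrite finv_f// -mulrDr.
  rewrite (shift T true injT) (shift N false injN) -big_split /=.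
  by apply: eq_bigr => y _; rewrite -mulrDr [X in _ * X]addrC.
apply: big1 => y _; apply/eqP; rewrite mulf_eq0; apply/orP; right; apply/eqP.
rewrite /phi /tgt /=.
have dbl (a b c d : 'F_2) : a + b + (c + d) + (a + c + (b + d)) = 0.
  have -> : a + b + (c + d) + (a + c + (b + d)) =
     (a + a) + (b + b) + ((c + c) + (d + d)) by ring.
  by rewrite !F2_addrr.
case: (sq y) => -[-> ->]; first exact: dbl.
by rewrite [X in _ + (_ + X)]addrC; exact: dbl.
Qed.

Definition D1 : 'Hom(chain (Y * bool)%type, chain Y) := linfun d1.
Definition D2 : 'Hom(chain Y, chain (Y * bool)%type) := linfun d2.

Lemma limg_D2_sub : (limg D2 <= lker D1)%VS.
Proof.
apply/subvP => c /memv_imgP[g _ ->]; rewrite memv_ker.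
by rewrite [D2 g]lfunE [D1 _]lfunE /= d1_d2.
Qed.

(** There are [#|Y|] nodes, [2 * #|Y|] edges and [#|Y|] squares. Connectedness of the grid gives
    [d1] rank at least [#|Y| - 1], so cycles have dimension at most [#|Y| + 1]; connectedness of the
    dual gives [d2] a kernel of dimension at most 1, so boundaries have dimension at least
    [#|Y| - 1]. *)
Lemma dim_cycles_boundaries (y0 : Y) : (\dim (lker D1) <= \dim (limg D2) + 2)%N.
Proof.
case: grid => injN injT EN TN _.
have k1 : (\dim (lker D1) + \dim (limg D1) = #|Y| * 2)%N.
  by have := limg_ker_dim D1 fullv; rewrite capfv dim_chain card_prod card_bool.
have k2 : (\dim (lker D2) + \dim (limg D2) = #|Y|)%N.
  by have := limg_ker_dim D2 fullv; rewrite capfv dim_chain.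
have addv1 v : (\dim (limg D1 + <[v]>) <= \dim (limg D1) + 1)%N.
  by have := dimv_sum_cap (limg D1) <[v]>; rewrite dim_vline; case: eqP => /=; lia.
(* Modulo boundaries of edges, membership of [delta y] propagates along edges, so adding [delta y0]
   yields the whole space. *)
have i1 : (#|Y| <= \dim (limg D1) + 1)%N.
  rewrite -(dim_chain Y); apply: leq_trans (addv1 (delta y0)); apply: dimvS.
  have edge a : (delta a.1 \in (limg D1 + <[delta y0]>)%VS) =
                (delta (tgt a) \in (limg D1 + <[delta y0]>)%VS).
    have im : (delta a.1 + delta (tgt a) \in (limg D1 + <[delta y0]>)%VS).
      rewrite -d1_delta; apply: (subvP (addvSl _ _)).
      have -> : d1 (delta a) = D1 (delta a) by rewrite lfunE.
      exact/memv_img/memvf.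
    apply/idP/idP => h; have := rpredB im h.
      by rewrite addrAC subrr add0r.
    by rewrite addrK.
  have all_in y : (delta y \in (limg D1 + <[delta y0]>)%VS).
    rewrite (EN (fun y => delta y \in (limg D1 + <[delta y0]>)%VS) _ _ y y0).
    - by apply: (subvP (addvSr _ _)); apply: memv_line.
    - by move=> z; rewrite (edge (z, false)).
    - by move=> z; rewrite (edge (z, true)).
  apply/subvP => g _; rewrite (chain_delta g); apply: rpred_sum => y _.
  exact: rpredZ.
(* A chain of squares with zero boundary takes equal values on both sides of every edge, hence is
   constant. *)
have i2 : (\dim (lker D2) <= 1)%N.
  apply: (@leq_trans (\dim <[[ffun=> 1] : chain Y]>)); last first.
    by rewrite dim_vline; case: eqP.
  apply/dimvS/subvP => g; rewrite memv_ker => /eqP; rewrite [D2 g]lfunE /= => /ffunP g0.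
  have side a : g a.1 = g (opp_side a) by apply: F2_eqP; have := g0 a; rewrite !ffunE.
  have gT y : g (T y) = g y by rewrite (side (T y, true)) /opp_side /= finv_f.
  have gN y : g (N y) = g y by rewrite (side (N y, false)) /opp_side /= finv_f.
  apply/vlineP; exists (g y0); apply/ffunP => y; rewrite !ffunE [_ *: _]mulr1.
  apply/eqP; rewrite (TN (fun y => g y == g y0) _ _ y y0) ?eqxx// => z.
    by rewrite gT.
  by rewrite gN.
lia.
Qed.

End GridHomology.

(** * Faces of a grid minor *)

Definition edge_set (V : finType) (e : rel V) : {set {set V}} :=
  [set A : {set V} | [exists u, exists v, e u v && (A == [set u; v])]].

Lemma edge_setP (V : finType) (e : rel V) (A : {set V}) :
  reflect (exists u v, e u v /\ A = [set u; v]) (A \in edge_set e).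
Proof.
rewrite inE; apply: (iffP existsP) => [[u /existsP[v /andP[euv /eqP ->]]]|].
  by exists u, v.
by move=> [u [v [euv ->]]]; exists u; apply/existsP; exists v; rewrite euv eqxx.
Qed.

Section MinorCycles.
Local Open Scope ring_scope.
Variables (V : finType) (e : rel V).
Hypothesis e_irr : irreflexive e.

Local Notation EG := {A : {set V} | A \in edge_set e}.

Definition bd (z : chain EG) : chain V := [ffun v => \sum_(a : EG | v \in val a) z a].

Lemma bd_is_linear : linear bd.
Proof.
move=> k c c'; apply/ffunP => x; rewrite !ffunE scaler_sumr -big_split /=.
by apply: eq_bigr => a _; rewrite !ffunE.
Qed.
HB.instance Definition _ := GRing.isLinear.Build _ _ _ _ bd bd_is_linear.

Definition cycles : {vspace chain EG} := lker (linfun bd).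

Lemma cyclesP (z : chain EG) : reflect (forall v, bd z v = 0) (z \in cycles).
Proof.
have -> : (z \in cycles) = (bd z == 0) by apply: lker_linfun.
apply: (iffP eqP) => [z0 v|z0]; first by rewrite z0 ffunE.
by apply/ffunP => v; rewrite z0 ffunE.
Qed.

Variables (Y : finType) (E N T : Y -> Y) (br : V -> {set Y}).
Hypothesis grid : quad_grid E N T.
Hypothesis br_disj : forall u v x, x \in br u -> x \in br v -> u = v.
Hypothesis br_conn : forall v x y, x \in br v -> y \in br v ->
  connect (rel_in (grid_adj E N) (mem (br v))) x y.
Hypothesis br_edge : forall u v, e u v -> exists x y,
  [/\ x \in br u, y \in br v & grid_adj E N x y].

Local Notation tgt := (tgt E N).

(** Grid edges are stored only in the directions [E] and [N], so the grid decides which end of an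
    edge becomes its tail. *)
Lemma edge_rep (a : EG) : exists w : (V * V) * (Y * bool),
  [&& w.1.1 != w.1.2, val a == [set w.1.1; w.1.2], w.2.1 \in br w.1.1
    & tgt w.2 \in br w.1.2].
Proof.
case: a => A AE; have [u [v [euv AE']]] := edge_setP _ _ AE.
have uv : u != v by apply: contraTneq euv => ->; rewrite e_irr.
have [x [y [xu yv]]] := br_edge euv.
have AE2 : A = [set v; u] by rewrite AE' setUC.
have vu : v != u by rewrite eq_sym.
case/or4P => /eqP xy.
- by exists ((u, v), (x, false)); rewrite /= uv -AE' eqxx xu /tgt /= -xy.
- by exists ((u, v), (x, true)); rewrite /= uv -AE' eqxx xu /tgt /= -xy.
- by exists ((v, u), (y, false)); rewrite /= vu -AE2 eqxx yv /tgt /= -xy.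
- by exists ((v, u), (y, true)); rewrite /= vu -AE2 eqxx yv /tgt /= -xy.
Qed.

Definition rep a := xchoose (edge_rep a).
Definition tail a := (rep a).1.1.
Definition head a := (rep a).1.2.
Definition eps a := (rep a).2.

Lemma tail_head a : tail a != head a.
Proof. by have /and4P[] := xchooseP (edge_rep a). Qed.

Lemma edgeE a : val a = [set tail a; head a].
Proof. by have /and4P[_ /eqP] := xchooseP (edge_rep a). Qed.

Lemma eps_tail a : (eps a).1 \in br (tail a).
Proof. by have /and4P[] := xchooseP (edge_rep a). Qed.

Lemma eps_head a : tgt (eps a) \in br (head a).
Proof. by have /and4P[] := xchooseP (edge_rep a). Qed.

Lemma eps_inj : injective eps.
Proof.
move=> a b ab; apply: val_inj; rewrite !edgeE.
have -> : tail a = tail b by apply: br_disj (eps_tail a) _; rewrite ab eps_tail.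
by have -> : head a = head b by apply: br_disj (eps_head a) _; rewrite ab eps_head.
Qed.

Definition inner v (s : Y * bool) := (s.1 \in br v) && (tgt s \in br v).

Lemma eps_not_inner v a : ~~ inner v (eps a).
Proof.
apply/negP => /andP[/(br_disj (eps_tail a)) ta /(br_disj (eps_head a)) ha].
by have := tail_head a; rewrite ta ha eqxx.
Qed.

(** The part of the grid that contracts to the graph: the edges inside branch sets and one
    representative per edge. Dropping any other edge merges the squares on its two sides. *)
Definition kept s := [exists v, inner v s] || (s \in codom eps).

Lemma connect_chain v x y : x \in br v -> y \in br v ->
  exists c : chain (Y * bool)%type, d1 E N c = delta x + delta y /\
    forall s, c s != 0 -> inner v s.
Proof.
move=> xv yv; have /connectP[p] := br_conn xv yv.
elim: p x xv => [|z p IH] x xv /=.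
  move=> _ ->; exists 0; rewrite linear0 chain_addrr; split=> // s.
  by rewrite ffunE eqxx.
move=> /andP[/and3P[xz _ zv] pz] yl; have [c [dc cin]] := IH z zv pz yl.
have [s [ds sin]] : exists s, d1 E N (delta s) = delta x + delta z /\ inner v s.
  rewrite /= in zv; case/or4P: xz => /eqP xz.
  - by exists (x, false); rewrite d1_delta /inner /tgt /= -xz xv.
  - by exists (x, true); rewrite d1_delta /inner /tgt /= -xz xv.
  - by exists (z, false); rewrite d1_delta /inner /tgt /= -xz addrC zv.
  - by exists (z, true); rewrite d1_delta /inner /tgt /= -xz addrC zv.
exists (delta s + c); split.
  rewrite linearD /= ds dc.
  by rewrite addrA -[X in X + _]addrA chain_addrr addr0.
move=> s'; rewrite ffunE; have [<- _ //|ss'] := eqVneq s s'.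
by rewrite ffunE (negPf ss') add0r; apply: cin.
Qed.

Definition rho (c : chain (Y * bool)%type) : chain EG := [ffun a => c (eps a)].

Lemma rho_is_linear : linear rho.
Proof. by move=> k c c'; apply/ffunP => x; rewrite !ffunE. Qed.
HB.instance Definition _ := GRing.isLinear.Build _ _ _ _ rho rho_is_linear.

Definition unkept (c : chain (Y * bool)%type) : chain (Y * bool)%type :=
  [ffun s => if kept s then 0 else c s].

Lemma unkept_is_linear : linear unkept.
Proof.
move=> k c c'; apply/ffunP => x; rewrite !ffunE; case: ifP => _ //.
by rewrite scaler0 addr0.
Qed.
HB.instance Definition _ := GRing.isLinear.Build _ _ _ _ unkept unkept_is_linear.

Definition kept_cycles : {vspace chain (Y * bool)%type} :=
  (lker (D1 E N) :&: lker (linfun unkept))%VS.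

Lemma kept_cyclesP c : reflect (d1 E N c = 0 /\ forall s, ~~ kept s -> c s = 0)
  (c \in kept_cycles).
Proof.
have -> : (c \in kept_cycles) = (d1 E N c == 0) && (unkept c == 0).
  by rewrite /kept_cycles memv_cap; congr andb; apply: lker_linfun.
apply: (iffP andP) => [[/eqP d0 /eqP /ffunP u0]|[-> u0]]; split=> //.
  by move=> s /negPf ks; have := u0 s; rewrite !ffunE ks.
by apply/eqP/ffunP => s; rewrite !ffunE; case: ifPn => // /u0.
Qed.

Variable y0 : Y.

(** The default [y0] stands for an empty branch set; the ends of an edge always have a genuine base
    point. *)
Definition base v := odflt y0 [pick x in br v].

Lemma base_in v x : x \in br v -> base v \in br v.
Proof. by rewrite /base; case: pickP => [y|/(_ x) ->]. Qed.

Lemma sum_over_ends (a : EG) (F : V -> 'F_2) :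
  F (tail a) + F (head a) = \sum_(v in val a) F v.
Proof. by rewrite edgeE big_setU1 ?big_set1// inE tail_head. Qed.

Lemma edge_lift a : exists c : chain (Y * bool)%type,
  [/\ d1 E N c = delta (base (tail a)) + delta (base (head a)), rho c = delta a
    & forall s, ~~ kept s -> c s = 0].
Proof.
have [c [dc cin]] := connect_chain (base_in (eps_tail a)) (eps_tail a).
have [c' [dc' cin']] := connect_chain (eps_head a) (base_in (eps_head a)).
have inner0 v (d : chain (Y * bool)%type) (s : Y * bool) :
    (forall s, d s != 0 -> inner v s) -> ~~ inner v s -> d s = 0.
  by move=> dv; apply: contraNeq; apply: dv.
exists (c + delta (eps a) + c'); split.
- have telescope (p q r s : chain Y) : p + q + (q + r) + (r + s) = p + s.
    by rewrite !addrA -(addrA p q q) chain_addrr addr0 -(addrA p r r) chain_addrr addr0.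
  by rewrite !linearD /= dc dc' d1_delta telescope.
- apply/ffunP => b; rewrite !ffunE (inner0 _ _ _ cin) ?eps_not_inner//.
  by rewrite (inner0 _ _ _ cin') ?eps_not_inner// add0r addr0 (inj_eq eps_inj).
- move=> s; rewrite negb_or => /andP[/existsPn ninn neps].
  rewrite !ffunE (inner0 _ _ _ cin)// (inner0 _ _ _ cin')// add0r addr0.
  by case: eqP => // es; move: neps; rewrite -es codom_f.
Qed.

(** Every edge of [z] is routed between the base points of its ends. The boundary of the sum has at
    [base v] the degree of [v] in [z], which vanishes mod 2. *)
Lemma cycle_lift z : z \in cycles -> exists2 c, c \in kept_cycles & rho c = z.
Proof.
move=> /cyclesP z0.
have [f fP] := fin_all_exists edge_lift.
exists (\sum_a z a *: f a); last first.
  rewrite linear_sum [RHS]chain_delta; apply: eq_bigr => a _.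
  by rewrite linearZ /=; case: (fP a) => _ ->.
apply/kept_cyclesP; split; last first.
  move=> s ks; rewrite sum_ffunE big1// => a _; rewrite ffunE.
  by case: (fP a) => _ _ ->//; rewrite scaler0.
rewrite linear_sum; apply/ffunP => x.
transitivity (\sum_(a : EG) \sum_(v in val a) z a * (base v == x)%:R : 'F_2).
  rewrite sum_ffunE; apply: eq_bigr => a _; rewrite linearZ /=.
  case: (fP a) => -> _ _; rewrite !ffunE -sum_over_ends -mulrDr.
  by [].
rewrite (exchange_big_dep predT)//= big1 ?ffunE// => v _.
rewrite -big_distrl /=; have := z0 v; rewrite !ffunE => ->.
by rewrite mul0r.
Qed.

(** The boundary of [c] is summed over the branch set of [v]. Kept edges inside a branch set have
    both ends in it or none and cancel, so only representatives of edges at [v] remain. *)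
Lemma rho_cycle c : c \in kept_cycles -> rho c \in cycles.
Proof.
move=> /kept_cyclesP[/ffunP dc ck]; apply/cyclesP => v; rewrite ffunE.
have mem_end u x : x \in br u -> (x \in br v)%:R = (u == v)%:R :> 'F_2.
  move=> xu; congr (_%:R); congr nat_of_bool.
  by apply/idP/eqP => [/(br_disj xu)|<-].
have tot : \sum_(s : Y * bool) c s * ((s.1 \in br v)%:R + (tgt s \in br v)%:R) = 0 :> 'F_2.
  transitivity (\sum_(x in br v) d1 E N c x : 'F_2); last first.
    by rewrite big1// => x _; rewrite dc ffunE.
  under [RHS]eq_bigr => x _ do rewrite ffunE.
  rewrite exchange_big /=; apply: eq_bigr => s _; rewrite -big_distrr /= big_split /=.
  have ind y : \sum_(x in br v) ((y == x)%:R : 'F_2) = (y \in br v)%:R.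
    rewrite big_mkcond /= (bigD1 y)//= eqxx big1 ?addr0; last first.
      by move=> x; rewrite eq_sym => /negPf ->; case: ifP.
    by case: (y \in br v).
  by rewrite !ind.
rewrite -[RHS]tot (bigID (mem (codom eps))) /= [X in _ + X]big1 ?addr0; last first.
  move=> s ns; have [ks|/ck ->] := boolP (kept s); last by rewrite mul0r.
  move: ks; rewrite /kept (negPf ns) orbF => /existsP[w /andP[sw tw]].
  by rewrite (mem_end _ _ sw) (mem_end _ _ tw) F2_addrr mulr0.
rewrite (eq_bigl (mem (eps @: [set: EG]))); last first.
  by move=> s; apply/codomP/imsetP => [[a ->]|[a _ ->]]; exists a.
rewrite big_imset /=; last by move=> a b _ _; apply: eps_inj.
rewrite big_mkcond [RHS]big_mkcond /=; apply: eq_bigr => a _; rewrite inE ffunE.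
rewrite (mem_end _ _ (eps_tail a)) (mem_end _ _ (eps_head a)).
have := tail_head a; rewrite edgeE !inE ![v == _]eq_sym.
by case: (tail a =P v) => [->|_]; case: (head a =P v) => [->|_];
  rewrite ?eqxx //= ?addr0 ?add0r ?mulr1 ?mulr0.
Qed.

(* The faces of the minor are the classes of squares linked through unkept edges. *)
Definition square_rel x y :=
  [exists s, ~~ kept s && [|| ((s.1, opp_side N T s) == (x, y)) |
                              ((opp_side N T s, s.1) == (x, y))]].

Lemma square_connect_sym : connect_sym square_rel.
Proof.
apply: sym_connect_sym => x y; apply: eq_existsb => s.
by rewrite orbC !xpair_eqE [(opp_side _ _ _ == x) && _]andbC [(_.1 == x) && _]andbC.
Qed.

Local Notation face := (fingraph.root square_rel).

Lemma face_kept s : ~~ kept s -> face s.1 = face (opp_side N T s).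
Proof.
move=> ks; apply/(fingraph.rootP square_connect_sym)/connect1/existsP.
by exists s; rewrite ks eqxx.
Qed.

Definition face_chain q : chain Y := [ffun y => (face y == q)%:R].

Definition face_boundary q : chain EG := rho (d2 N T (face_chain q)).

Lemma face_boundaryE q a : face_boundary q a =
  (face (eps a).1 == q)%:R + (face (opp_side N T (eps a)) == q)%:R.
Proof. by rewrite !ffunE. Qed.

Lemma face_chain_kept q : d2 N T (face_chain q) \in kept_cycles.
Proof.
apply/kept_cyclesP; split; first exact: d1_d2.
by move=> s ks; rewrite !ffunE (face_kept ks) F2_addrr.
Qed.

Lemma face_boundary_cycle q : face_boundary q \in cycles.
Proof. exact/rho_cycle/face_chain_kept. Qed.

(** If no unkept edge lies on the boundary of [g], then [g] does not change across unkept edges, so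
    it is constant on faces and a combination of the [face_chain q]. *)
Lemma kept_boundary_span g : d2 N T g \in kept_cycles ->
  rho (d2 N T g) \in <<codom face_boundary>>%VS.
Proof.
move=> /kept_cyclesP[_ gk].
have gstep x y : square_rel x y -> g x = g y.
  move=> /existsP[s /andP[/gk]]; rewrite ffunE => /F2_eqP gs.
  by case/orP => /eqP[<- <-].
have gface y : g y = g (face y).
  have /connectP[p pp ->] := connect_root square_rel y.
  by elim: p y pp => //= z p IH y /andP[/gstep -> /IH].
have -> : g = \sum_q g q *: face_chain q.
  apply/ffunP => y; rewrite sum_ffunE (bigD1 (face y))//=.
  rewrite big1 => [|q qy]; last first.
    by rewrite ffunE [face_chain q y]ffunE eq_sym (negPf qy) [_ *: _]mulr0.
  by rewrite addr0 ffunE [face_chain _ y]ffunE eqxx [_ *: _]mulr1 -gface.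
have -> : rho (d2 N T (\sum_q g q *: face_chain q)) =
    \sum_q g q *: face_boundary q.
  rewrite linear_sum linear_sum; apply: eq_bigr => q _.
  by rewrite linearZ linearZ.
apply: rpred_sum => q _; apply: rpredZ; apply: memv_span.
exact: codom_f.
Qed.

(** The quotient of [K] by its intersection with [I] embeds in that of [Z] by [I], so the
    intersection has codimension at most 2 in [K]. Now [rho] maps [K] onto the cycles and the
    intersection into the span of the faces. *)
Lemma dim_cycles_faces : (\dim cycles <= \dim <<codom face_boundary>> + 2)%N.
Proof.
pose I := limg (D2 N T); pose Z := lker (D1 E N); pose K := kept_cycles.
have IZ : (I <= Z)%VS := limg_D2_sub grid.
have KZ : (K <= Z)%VS by apply: capvSl.
have h1 : (\dim Z <= \dim I + 2)%N := dim_cycles_boundaries grid y0.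
have h2 : (\dim (K + I) <= \dim Z)%N by apply: dimvS; rewrite subv_add KZ.
have h3 := dimv_sum_cap K I.
have h4 := dim_limg_sub (linfun rho) (capvSl K I).
have h5 : (\dim cycles <= \dim (linfun rho @: K))%N.
  apply/dimvS/subvP => z /cycle_lift[c cK <-].
  have -> : rho c = linfun rho c by rewrite lfunE.
  exact: memv_img.
have h6 : (\dim (linfun rho @: (K :&: I)) <= \dim <<codom face_boundary>>)%N.
  apply/dimvS/subvP => z /memv_imgP[c]; rewrite memv_cap => /andP[cK /memv_imgP[g _ cg]] ->.
  move: cK; rewrite cg.
  have -> : D2 N T g = d2 N T g by apply: (lfunE (d2 N T)).
  have -> : linfun rho (d2 N T g) = rho (d2 N T g) by apply: (lfunE rho).
  exact: kept_boundary_span.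
have arith z i k ki kIi c rk rki sp : (z <= i + 2 -> ki <= z -> ki + kIi = k + i ->
  rk + kIi <= rki + k -> c <= rk -> rki <= sp -> c <= sp + 2)%N by lia.
exact: arith h1 h2 h3 h4 h5 h6.
Qed.

End MinorCycles.

(** * Cycles and even subgraphs *)

Lemma set2_eq (T : finType) (a b c d : T) : [set a; b] = [set c; d] ->
  (a = c /\ b = d) \/ (a = d /\ b = c).
Proof.
move=> E.
have /set2P[ac|ad] : a \in [set c; d] by rewrite -E set21.
  have /set2P[da|db] : d \in [set a; b] by rewrite E set22.
    have /set2P[bc|bd] : b \in [set c; d] by rewrite -E set22.
      by left; rewrite da bc ac.
    by left.
  by left.
have /set2P[ca|cb] : c \in [set a; b] by rewrite E set21.
  have /set2P[bc|bd] : b \in [set c; d] by rewrite -E set22.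
    by right.
  by right; rewrite bd ca ad.
by right.
Qed.

(** Take a longest path. Its first vertex has a neighbor other than its successor; by maximality
    that neighbor lies on the path and closes a cycle. *)
Lemma exists_cycle (T : finType) (r : rel T) (x0 y0 : T) :
  irreflexive r -> symmetric r -> r x0 y0 ->
  (forall x y, r x y -> exists2 z, z != x & r y z) ->
  exists2 c, ucycle r c & (2 < size c)%N.
Proof.
move=> r_irr r_sym r0 ext.
have xy0 : x0 != y0 by apply: contraTneq r0 => ->; rewrite r_irr.
pose P n := [exists p : n.-tuple T, exists x, path r x p && uniq (x :: p)].
have P1 : exists n, P n.
  exists 1%N; apply/existsP; exists [tuple y0]; apply/existsP; exists x0.
  by rewrite /= r0 inE xy0.
have Pbound n : P n -> (n <= #|T|)%N.
  move=> /existsP[p /existsP[x /andP[_ /card_uniqP up]]].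
  by have := max_card (mem (x :: p)); rewrite up /= size_tuple => /ltnW.
have [n /existsP[p /existsP[x /andP[px ux]]] nmax] := ex_maxnP P1 Pbound.
have [y [p' pE]] : exists y p', tval p = y :: p'.
  have : (0 < size p)%N.
    rewrite size_tuple; apply: nmax; apply/existsP; exists [tuple y0].
    by apply/existsP; exists x0; rewrite /= r0 inE xy0.
  by case: (tval p) => // y p' _; exists y, p'.
have rxy : r x y by move: px; rewrite pE /= => /andP[].
have [w wy rxw] : exists2 w, w != y & r x w by apply: ext; rewrite r_sym.
have wx : w != x by apply: contraTneq rxw => ->; rewrite r_irr.
have wp : w \in tval p.
  apply: contraT => wp; have : (n < n)%N; last by rewrite ltnn.
  apply: nmax; apply/existsP; exists (cons_tuple x p); apply/existsP; exists w.
  by rewrite /= r_sym rxw px /= inE negb_or wx wp /=; move: ux => /= /andP[-> ->].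
have [p1 [p2 pE']] : exists p1 p2, tval p = rcons p1 w ++ p2.
  by case/splitPr: wp => p1 p2; exists p1, p2; rewrite cat_rcons.
exists (x :: rcons p1 w).
  rewrite /ucycle /= rcons_path last_rcons r_sym rxw andbT.
  move: px ux; rewrite pE' cat_path => /andP[-> _] /=.
  by rewrite mem_cat negb_or cat_uniq => /andP[/andP[-> _] /and3P[-> _ _]].
case: p1 pE' => [|z p1] pE'; last by rewrite /= size_rcons.
by move: wy; rewrite pE in pE'; case: pE' => ->; rewrite eqxx.
Qed.

Section CycleEdges.
Variables (V : finType) (c : seq V).
Hypotheses (c_uniq : uniq c) (c_size : (2 < size c)%N).

Lemma next_neq x : x \in c -> next c x != x.
Proof.
move=> xc; have [i s rE] := rot_to xc.
have u : uniq (x :: s) by rewrite -rE rot_uniq.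
rewrite -(next_rot i) // rE; case: s rE u => [|y s] rE u.
  by move: c_size; rewrite -(size_rot i) rE.
by rewrite /= eqxx; move: u; rewrite /= inE negb_or eq_sym => /andP[/andP[]].
Qed.

Lemma next_next_neq x : x \in c -> next c (next c x) != x.
Proof.
move=> xc; have [i s rE] := rot_to xc.
have u : uniq (x :: s) by rewrite -rE rot_uniq.
have nE := next_rot i c_uniq.
rewrite -!nE rE; case: s rE u => [|y [|z s]] rE u;
  try by move: c_size; rewrite -(size_rot i) rE.
rewrite /= eqxx; move: u; rewrite /= !inE !negb_or => /andP[/and3P[xy xz _] _].
by rewrite [y == x]eq_sym (negPf xy) eqxx eq_sym.
Qed.

Lemma cycle_edge_inj : {in c &, injective (fun x => [set x; next c x])}.
Proof.
move=> x y xc yc /set2_eq[[]//|[xny nxy]].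
by have := next_next_neq xc; rewrite nxy -xny eqxx.
Qed.

Lemma card_cycle_edges : #|cycle_edges c| = size c.
Proof. by rewrite card_in_imset ?(card_uniqP c_uniq)//; apply: cycle_edge_inj. Qed.

Lemma cycle_edges_at v : [set A in cycle_edges c | v \in A] =
  if v \in c then [set [set v; next c v]; [set prev c v; v]] else set0.
Proof.
apply/setP => A; rewrite inE; apply/andP/idP => [[/imsetP[x xc ->]]|].
  rewrite !inE => /orP[/eqP ->|/eqP vx]; first by rewrite xc !inE eqxx.
  by rewrite vx mem_next xc prev_next// !inE eqxx orbT.
case: ifP => vc; last by rewrite inE.
rewrite !inE => /orP[/eqP ->|/eqP ->].
  by split; [apply/imsetP; exists v|rewrite !inE eqxx].
split; last by rewrite !inE eqxx orbT.
by apply/imsetP; exists (prev c v); rewrite ?mem_prev// next_prev.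
Qed.

Lemma card_cycle_edges_at v :
  #|[set A in cycle_edges c | v \in A]| = ((v \in c) * 2)%N.
Proof.
rewrite cycle_edges_at; case: ifP => vc; last by rewrite cards0.
rewrite cards2; case: eqP => // /set2_eq[[vp _]|[_ np]].
  by have := next_neq (x := prev c v); rewrite mem_prev next_prev// -vp eqxx vc => /(_ isT).
have pc : prev c v \in c by rewrite mem_prev.
by have := next_next_neq pc; rewrite next_prev// np eqxx.
Qed.

End CycleEdges.

Definition five_cycles (V : finType) (e : rel V) : {set {set {set V}}} :=
  [set A | [exists c : 5.-tuple V, [&& cycle e c, uniq c & A == cycle_edges c]]].

Lemma five_cyclesP (V : finType) (e : rel V) A :
  reflect (exists2 c, is_cycle e 5 c & A = cycle_edges c) (A \in five_cycles e).
Proof.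
rewrite inE; apply: (iffP existsP) => [[c /and3P[ec uc /eqP ->]]|].
  by exists c => //; split; [apply/andP|rewrite size_tuple].
move=> [c [/andP[ec uc] sc] ->].
have sc' : size c == 5 by apply/eqP.
by exists (Tuple sc'); rewrite /= ec uc eqxx.
Qed.

(** * Even subgraphs in the absence of short cycles *)

Section ShortCycles.
Variables (V : finType) (e : rel V).
Hypotheses (e_sym : symmetric e) (e_irr : irreflexive e).
Hypotheses (no_C3 : ~ has_cycle e 3) (no_C4 : ~ has_cycle e 4)
  (no_C6 : ~ has_cycle e 6).

Lemma edge_set2 u v : ([set u; v] \in edge_set e) = e u v.
Proof.
apply/edge_setP/idP => [[x [y [exy]]]|euv]; last by exists u, v.
by move=> /set2_eq[[-> ->]|[-> ->]]; rewrite // e_sym.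
Qed.

(** No degree in [S] is 1, so [S] contains a cycle, of length 5 or at least 7. If [S] had six edges,
    it would be a 5-cycle plus one edge, and an end of that edge would have odd degree. *)
Lemma even_edge_set (S : {set {set V}}) : S \subset edge_set e ->
  (forall v, ~~ odd #|[set A in S | v \in A]|) -> S != set0 ->
  [/\ 5 <= #|S|, #|S| != 6 & #|S| = 5 -> S \in five_cycles e].
Proof.
move=> /subsetP Se even /set0Pn[A0 A0S].
pose r u v := [set u; v] \in S.
have re u v : r u v -> e u v by move=> /Se; rewrite edge_set2.
have /edge_setP[x0 [y0 [_ A0E]]] := Se _ A0S.
have [||||c /andP[cr cu] cs] := @exists_cycle V r x0 y0.
- by move=> u; apply/negP => /re; rewrite e_irr.
- by move=> u v; rewrite /r setUC.
- by rewrite /r -A0E.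
- move=> x y; rewrite /r => rxy.
  have : [set A in S | y \in A] :\ [set x; y] != set0.
    apply/negP => /eqP D0; have := even y.
    by rewrite (cardsD1 [set x; y]) D0 cards0 addn0 inE rxy !inE eqxx orbT.
  move=> /set0Pn[B]; rewrite !inE => /and3P[Bxy BS yB].
  have /edge_setP[a [b [eab BE]]] := Se _ BS.
  move: yB Bxy BS; rewrite BE !inE => /orP[] /eqP <- Bxy BS.
    by exists b => //; apply: contraNneq Bxy => ->; rewrite setUC.
  exists a; last by rewrite /r setUC.
  by apply: contraNneq Bxy => ->.
have ec : cycle e c by apply: sub_cycle cr => u v /re.
have size_c k : ~ has_cycle e k -> size c <> k.
  by move=> nk ck; apply: nk; exists c; split=> //; apply/andP.
have c5 : 5 <= size c.
  by case: (size c) cs (size_c _ no_C3) (size_c _ no_C4) => [|[|[|[|[|n]]]]].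
have c6 := size_c _ no_C6.
have cS : cycle_edges c \subset S.
  by apply/subsetP => A /imsetP[x xc ->]; exact: (next_cycle cr xc).
have := subset_leq_card cS; rewrite card_cycle_edges// => cardS.
split; first exact: leq_trans c5 cardS.
  apply/negP => /eqP S6; have c5' : size c = 5.
    by rewrite S6 in cardS; move: c5 c6 cardS; move: (size c) => n; lia.
  have /cards1P[B BE] : #|S :\: cycle_edges c| == 1.
    have := cardsID (cycle_edges c) S; rewrite (setIidPr cS) card_cycle_edges//.
    by rewrite S6 c5' => /eqP; rewrite (eqn_add2l 5 _ 1).
  have BS : B \in S by have := set11 B; rewrite -BE inE => /andP[].
  have /edge_setP[a [b [_ Bab]]] := Se _ BS.
  have := even a; rewrite -(cardsID (cycle_edges c)) oddD.
  have -> : [set A in S | a \in A] :&: cycle_edges c =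
      [set A in cycle_edges c | a \in A].
    apply/setP => A; rewrite !inE; case Ac: (A \in cycle_edges c).
      by rewrite (subsetP cS _ Ac) andbT.
    by rewrite andbF.
  have -> : [set A in S | a \in A] :\: cycle_edges c = [set B].
    apply/setP => A; rewrite in_setD in_set in_set1 andbA.
    have -> : (A \notin cycle_edges c) && (A \in S) = (A == B).
      by rewrite -in_set1 -BE in_setD.
    by case: eqP => // ->; rewrite Bab set21.
  by rewrite card_cycle_edges_at// cards1 oddM andbF.
move=> S5; apply/five_cyclesP; exists c.
  split; first exact/andP.
  by apply/eqP; rewrite eqn_leq c5 andbT -S5.
by apply/esym/eqP; rewrite eqEcard cS card_cycle_edges// S5.
Qed.

Local Notation EG := {A : {set V} | A \in edge_set e}.
Local Open Scope ring_scope.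

Definition supp (z : chain EG) : {set {set V}} := [set val a | a : EG & z a != 0].

Lemma natF2_eq0 n : (n%:R == 0 :> 'F_2) = ~~ odd n.
Proof.
have -> : n%:R = (odd n)%:R :> 'F_2.
  rewrite -{1}(odd_double_half n) natrD -muln2 natrM.
  by rewrite (_ : 2%:R = 0) ?mulr0 ?addr0//; apply/eqP.
by case: odd.
Qed.

Lemma sumF2 (T : finType) (P : pred T) (z : T -> 'F_2) :
  \sum_(a | P a) z a = #|[set a | P a & z a != 0]|%:R.
Proof.
rewrite -sum1_card natr_sum big_mkcond [RHS]big_mkcond /=.
apply: eq_bigr => a _; rewrite inE; case: (P a) => //=.
by case: (z a) => -[|[|//]] i; apply/eqP.
Qed.

Lemma card_supp z : #|supp z| = #|[set a : EG | z a != 0]|.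
Proof. by rewrite card_imset //; apply: val_inj. Qed.

Lemma supp_inj : injective supp.
Proof.
move=> z z' zz'; apply/ffunP => a.
have mem_supp (y : chain EG) : (val a \in supp y) = (y a != 0).
  by rewrite mem_imset ?inE//; apply: val_inj.
have := mem_supp z; rewrite zz' mem_supp.
by move: (z a) (z' a) => [[|[|//]] i] [[|[|//]] j]; rewrite // => _; apply/eqP.
Qed.

Lemma cycle_supp z : z \in cycles e -> z != 0 ->
  [/\ 5 <= #|supp z|, #|supp z| != 6 & #|supp z| = 5 -> supp z \in five_cycles e]%N.
Proof.
move=> /cyclesP zc z0; apply: even_edge_set.
- by apply/subsetP => A /imsetP[a _ ->]; apply: valP.
- move=> v; have := zc v; rewrite ffunE sumF2 => /eqP.
  rewrite natF2_eq0; congr (~~ odd _).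
  rewrite -[LHS](card_imset _ val_inj); apply: eq_card => A.
  rewrite [RHS]inE; apply/imsetP/andP => [[a]|[/imsetP[a za ->] va]].
    by rewrite inE => /andP[va za] ->; split=> //; apply: imset_f; rewrite inE.
  by exists a => //; rewrite inE va; rewrite inE in za.
- rewrite -card_gt0 card_supp card_gt0; apply: contra z0 => /eqP/setP z0.
  by apply/eqP/ffunP => a; rewrite ffunE; have := z0 a; rewrite !inE => /negbFE/eqP.
Qed.

End ShortCycles.

(** * Counting faces *)

Section FaceCount.
Local Open Scope ring_scope.
Variables (V : finType) (e : rel V).
Hypotheses (e_sym : symmetric e) (e_irr : irreflexive e).
Hypotheses (no_C3 : ~ has_cycle e 3) (no_C4 : ~ has_cycle e 4)
  (no_C6 : ~ has_cycle e 6).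
Hypothesis C5_disjoint : forall A B, A \in five_cycles e -> B \in five_cycles e ->
  A != B -> [disjoint A & B].

Local Notation EG := {A : {set V} | A \in edge_set e}.

Lemma card_EG : #|{: EG}| = #|edge_set e|.
Proof. by rewrite card_sig. Qed.

(** The boundary of an edge is a sum of two vectors [delta w0 + delta v], so the rank of [bd] is
    less than the number of nonisolated vertices. *)
Lemma dim_cycles w0 : w0 \in cover (edge_set e) ->
  (#|edge_set e| + 1 <= \dim (cycles e) + #|cover (edge_set e)|)%N.
Proof.
move=> w0W; pose W := cover (edge_set e).
pose s := [seq delta w0 + delta v | v <- enum (W :\ w0)] : seq (chain V).
have inW v : v \in W -> delta w0 + delta v \in <<s>>%VS.
  move=> vW; have [->|vw] := eqVneq v w0; first by rewrite chain_addrr mem0v.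
  by apply/memv_span/map_f; rewrite mem_enum !inE vw.
have sub : (limg (linfun (bd (e := e))) <= <<s>>)%VS.
  apply/subvP => z /memv_imgP[c _ ->]; have -> : linfun (bd (e:=e)) c = bd c by apply: lfunE.
  rewrite (chain_delta c) linear_sum; apply: rpred_sum => a _; rewrite linearZ /=.
  apply: rpredZ.
  have /edge_setP[u [v [euv auv]]] := valP a.
  have uv : u != v by apply: contraTneq euv => ->; rewrite e_irr.
  have -> : bd (delta a) = delta w0 + delta u + (delta w0 + delta v).
    rewrite addrACA chain_addrr add0r; apply/ffunP => x; rewrite !ffunE.
    rewrite big_mkcond (bigD1 a)//= ffunE eqxx big1 ?addr0; last first.
      by move=> b ba; rewrite ffunE eq_sym (negPf ba); case: ifP.
    rewrite auv !inE [u == x]eq_sym [v == x]eq_sym.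
    case: (x =P u) => [->|_]; last by rewrite add0r; case: eqP.
    by rewrite (negPf uv) addr0.
  have aW x : x \in val a -> x \in W by move=> xa; apply/bigcupP; exists (val a) => //; apply: valP.
  by apply: rpredD; apply: inW; apply: aW; rewrite auv ?set21 ?set22.
have h1 := limg_ker_dim (linfun (bd (e := e))) fullv.
rewrite capfv dim_chain card_EG in h1.
have h2 : (\dim (limg (linfun (bd (e:=e)))) <= #|W :\ w0|)%N.
  apply: leq_trans (dimvS sub) _; apply: leq_trans (dim_span _) _.
  by rewrite size_map -cardE.
have h3 : (#|W| = #|W :\ w0| + 1)%N by rewrite (cardsD1 w0) w0W addnC.
have arith (ed dc k w w1 : nat) : (k + dc = ed -> dc <= w1 -> w = w1 + 1 -> ed + 1 <= k + w)%N by lia.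
exact: arith h1 h2 h3.
Qed.

Variables (Y : finType) (r : Y -> chain EG) (f1 f2 : EG -> Y).
Hypothesis r_cycle : forall q, r q \in cycles e.
Hypothesis rE : forall q a, r q a = (f1 a == q)%:R + (f2 a == q)%:R.

Lemma sum_faces a : \sum_q r q a = 0 :> 'F_2.
Proof.
under eq_bigr => q _ do rewrite rE.
have one (y : Y) : \sum_(q : Y) ((y == q)%:R : 'F_2) = 1.
  rewrite (bigD1 y)//= eqxx big1 ?addr0// => x.
  by rewrite eq_sym => /negPf ->.
by rewrite big_split /= !one F2_addrr.
Qed.

Local Notation len q := #|supp (r q)|.

Lemma sum_len : (\sum_q len q <= 2 * #|edge_set e|)%N.
Proof.
under eq_bigr => q _ do rewrite card_supp -sum1_card big_mkcond /=.
rewrite exchange_big /= mulnC -card_EG -sum_nat_const.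
(* This set is a singleton for an edge with the same face on both sides; such an edge lies on no
   boundary, as its two contributions cancel. *)
apply: leq_sum => a _; apply: (@leq_trans #|[set f1 a; f2 a]|); last first.
  by rewrite cards2; case: eqP.
rewrite -sum1_card [X in (_ <= X)%N]big_mkcond /=; apply: leq_sum => q _.
rewrite !inE rE [q == f1 a]eq_sym [q == f2 a]eq_sym.
by case: (f1 a == q); case: (f2 a == q).
Qed.

Lemma len_cases q : r q != 0 -> (len q == 5) || (7 <= len q)%N.
Proof.
move=> rq; have [h5 h6 _] := cycle_supp e_sym e_irr no_C3 no_C4 no_C6 (r_cycle q) rq.
by case: #|supp (r q)| h5 h6 => [|[|[|[|[|[|[|n]]]]]]].
Qed.

(** Equal boundaries are counted once, through a representative chosen from the boundary alone.
    Leaving out [q0] costs no dimension, since its boundary is the sum of all others. *)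
Lemma distinct_faces (q0 : option Y) : exists Q : {set Y},
  [/\ (forall q, q \in Q -> r q != 0 /\ Some q != q0), {in Q &, injective r}
    & (\dim <<codom r>> <= #|Q|)%N].
Proof.
pose P q := (r q != 0) && (Some q != q0).
pose rp q := odflt q [pick q' | P q' && (r q' == r q)].
have rpP q : P q -> P (rp q) /\ r (rp q) = r q.
  rewrite /rp; case: pickP => [q' /andP[Pq' /eqP]//|/(_ q)].
  by rewrite eqxx andbT => /= ->.
have rp_eq q q' : r q = r q' -> P q -> P q' -> rp q = rp q'.
  move=> rqq' Pq Pq'; rewrite /rp rqq'.
  by case: pickP => // /(_ q'); rewrite Pq' eqxx.
pose Q := [set q | P q && (rp q == q)].
have inQ q : P q -> rp q \in Q.
  move=> Pq; have [Prp rrp] := rpP q Pq; rewrite inE Prp /=; apply/eqP.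
  exact: rp_eq.
exists Q; split.
- by move=> q; rewrite inE => /andP[/andP[]].
- move=> q q'; rewrite !inE => /andP[Pq /eqP <-] /andP[Pq' /eqP <-] rqq'.
  have [Prq _] := rpP q Pq; have [Prq' _] := rpP q' Pq'.
  have := rp_eq _ _ rqq' Prq Prq'.
  have idem p : P p -> rp (rp p) = rp p.
    by move=> Pp; have /inQ := Pp; rewrite inE => /andP[_ /eqP].
  by rewrite !idem.
apply: (@leq_trans (\dim <<[seq r q | q <- enum Q]>>)); last first.
  by apply: leq_trans (dim_span _) _; rewrite size_map -cardE.
apply/dimvS/span_subvP => z /codomP[q ->].
have main p : Some p != q0 -> r p \in <<[seq r q | q <- enum Q]>>%VS.
  move=> pq0; have [->|rp0] := eqVneq (r p) 0; first exact: mem0v.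
  have Pp : P p by apply/andP.
  have [_ <-] := rpP p Pp; apply/memv_span/map_f; rewrite mem_enum; exact: inQ.
have [qq0|] := eqVneq (Some q) q0; last exact: main.
have -> : r q = \sum_(p | p != q) r p.
  apply/ffunP => a; rewrite sum_ffunE; apply: F2_eqP.
  by rewrite -(bigD1 q (F := fun p => r p a) (P := predT))//=; apply: sum_faces.
by apply: rpred_sum => p pq; apply: main; rewrite -qq0.
Qed.

(** The cycle space has dimension at least the number of edges minus the number of nonisolated
    vertices plus 1, and the faces miss at most 2 of it. *)
Hypothesis dimE : (#|edge_set e| <= \dim <<codom r>> + #|cover (edge_set e)| + 1)%N.

(* The two extra dimensions of the torus or Klein bottle are absorbed by dropping a
   face of length at least 7, which is the sum of the other ones; if there is none,
   all faces are edge-disjoint 5-cycles. *)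
Lemma face_count :
  (5 * #|edge_set e| <= 7 * #|cover (edge_set e)| + 2 * #|five_cycles e|)%N \/
  (4 * #|edge_set e| <= 5 * #|cover (edge_set e)| + 5)%N.
Proof.
have [/existsP[q0 q07]|/existsPn no7] := boolP [exists q, (7 <= len q)%N].
  left; have [Q [Q0 Qinj dQ]] := distinct_faces (Some q0).
  have n5 : (#|[set q in Q | len q == 5]| <= #|five_cycles e|)%N.
    rewrite -(card_in_imset (f := fun q => supp (r q))); last first.
      move=> q q'; rewrite !inE => /andP[qQ _] /andP[q'Q _] /supp_inj.
      exact: Qinj.
    apply/subset_leq_card/subsetP => _ /imsetP[q + ->]; rewrite inE => /andP[qQ /eqP l5].
    have [rq0 _] := Q0 q qQ.
    by have [_ _] := cycle_supp e_sym e_irr no_C3 no_C4 no_C6 (r_cycle q) rq0; apply.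
  (* A selected face has length at least 7 or exactly 5, and then 2 makes up the difference. *)
  have low : (7 * #|Q| <= \sum_(q in Q) len q + 2 * #|[set q in Q | len q == 5]|)%N.
    rewrite -!sum1_card !big_distrr /=.
    rewrite [X in (_ <= _ + X)%N](eq_bigl (fun q => (q \in Q) && (len q == 5))); last first.
      by move=> q; rewrite inE.
    rewrite [X in (_ <= _ + X)%N]big_mkcondr -big_split /=; apply: leq_sum => q qQ.
    have [rq0 _] := Q0 q qQ; have := len_cases rq0.
    by case: eqP => [->//|_] /=; lia.
  have up : (\sum_(q in Q) len q + 7 <= 2 * #|edge_set e|)%N.
    apply: leq_trans sum_len; rewrite [X in (_ <= X)%N](bigD1 q0)//= addnC leq_add//.
    rewrite big_mkcond [X in (_ <= X)%N]big_mkcond; apply: leq_sum => q _.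
    case: ifP => // qQ; have [_ qq0] := Q0 q qQ.
    by case: eqP => // qq; rewrite qq eqxx in qq0.
  have arith (E d w c Q5 q s : nat) : (E <= d + w + 1 -> d <= q -> Q5 <= c ->
    7 * q <= s + 2 * Q5 -> s + 7 <= 2 * E -> 5 * E <= 7 * w + 2 * c)%N by lia.
  exact: arith dimE dQ n5 low up.
right; have [Q [Q0 Qinj dQ]] := distinct_faces None.
have five q : q \in Q -> len q = 5%N /\ supp (r q) \in five_cycles e.
  move=> qQ; have [rq0 _] := Q0 q qQ; have := len_cases rq0.
  rewrite (negPf (no7 q)) orbF => /eqP l5; split=> //.
  by have [_ _] := cycle_supp e_sym e_irr no_C3 no_C4 no_C6 (r_cycle q) rq0; apply.
have up : (5 * #|Q| <= #|edge_set e|)%N.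
  have triv : trivIset [set supp (r q) | q in Q].
    apply/trivIsetP => _ _ /imsetP[q qQ ->] /imsetP[q' q'Q ->].
    by apply: C5_disjoint; [case: (five q qQ)|case: (five q' q'Q)].
  have : (#|cover [set supp (r q) | q in Q]| <= #|edge_set e|)%N.
    apply/subset_leq_card/bigcupsP => _ /imsetP[q _ ->].
    by apply/subsetP => A /imsetP[a _ ->]; apply: valP.
  apply: leq_trans; rewrite -(eqP triv) big_imset /=; last first.
    by move=> q q' qQ q'Q /supp_inj; apply: Qinj.
  rewrite (eq_bigr (fun => 5%N)); last by move=> q /five[].
  by rewrite sum_nat_const mulnC.
have arith (E d w q : nat) : (E <= d + w + 1 -> d <= q -> 5 * q <= E ->
   4 * E <= 5 * w + 5)%N by lia.
exact: arith dimE dQ up.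
Qed.

End FaceCount.

Lemma grid_minor_sparse (V : finType) (e : rel V) :
  symmetric e -> irreflexive e -> grid_minor e ->
  ~ has_cycle e 3 -> ~ has_cycle e 4 -> ~ has_cycle e 6 ->
  (forall A B, A \in five_cycles e -> B \in five_cycles e ->
    A != B -> [disjoint A & B]) ->
  edge_set e != set0 ->
  (5 * #|edge_set e| <= 7 * #|cover (edge_set e)| + 2 * #|five_cycles e|) \/
  (4 * #|edge_set e| <= 5 * #|cover (edge_set e)| + 5).
Proof.
move=> e_sym e_irr [Y [E [N [T [br [grid disj conn edge]]]]]] C3 C4 C6 C5.
move=> /set0Pn[A AE]; have [u [v [euv Auv]]] := edge_setP _ _ AE.
have [y0 [_ _]] := edge _ _ euv.
have uW : u \in cover (edge_set e).
  by apply/bigcupP; exists A => //; rewrite Auv set21.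
have h1 := dim_cycles e_irr uW.
have h2 := dim_cycles_faces e_irr grid disj conn edge y0.
have arith (ed d w f : nat) : ed + 1 <= d + w -> d <= f + 2 -> ed <= f + w + 1 by lia.
have {h1 h2} h := arith _ _ _ _ h1 h2.
exact: (face_count e_sym e_irr C3 C4 C6 C5 (face_boundary_cycle e_irr grid disj edge)
  (face_boundaryE e_irr T edge) h).
Qed.

(** * Odd colorings *)

Section OddAt.
Variables (V : finType) (C : choiceType).
Implicit Types (e : rel V) (f : V -> C).

Definition nbrs e v := [set u | e v u].

Definition recolor f t c : V -> C := fun x => if x == t then c else f x.

Lemma recolor_eq f t c : recolor f t c t = c.
Proof. by rewrite /recolor eqxx. Qed.

Lemma recolor_neq f t c x : x != t -> recolor f t c x = f x.
Proof. by rewrite /recolor => /negPf ->. Qed.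

Lemma odd_at_local e e' f f' v : (forall u, e v u = e' v u) ->
  (forall u, e v u -> f u = f' u) -> odd_at e f v -> odd_at e' f' v.
Proof.
move=> ee ff [c oc]; exists c; rewrite (_ : [set u | _ & _] = [set u | e v u & f u == c])//.
apply/setP => u; rewrite !inE -ee; case evu: (e v u) => //=.
by rewrite ff.
Qed.

(** If every color class were even, so would be their sum, the degree. *)
Lemma odd_at_degree e f v : odd #|nbrs e v| -> odd_at e f v.
Proof.
move=> ov.
have [/existsP[u ou]|/existsPn none] :=
    boolP [exists u, odd #|[set w | e v w & f w == f u]|].
  by exists (f u).
move: ov; rewrite (card_partition (preim_partitionP f (nbrs e v))).
suff -> : odd (\sum_(A in preim_partition f (nbrs e v)) #|A|) = false by [].
apply/negbTE; elim/big_ind: _ => // [m n|A /imsetP[u _ ->]].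
  by rewrite oddD => /negPf -> /negPf ->.
have := none u; congr (~~ odd _); apply: eq_card => w.
by rewrite !inE eq_sym.
Qed.

Lemma odd_at_two e f v a b : nbrs e v = [set a; b] -> a != b -> f a != f b ->
  odd_at e f v.
Proof.
move=> /setP nv ab fab; exists (f a).
rewrite (_ : [set u | _ & _] = [set a]) ?cards1//.
apply/setP => u; have := nv u; rewrite !inE => ->.
have [->|ua] /= := eqVneq u a; first by rewrite eqxx.
by case: eqP => // ->; rewrite eq_sym (negPf fab).
Qed.

Lemma odd_at_two_neq e f v a b : nbrs e v = [set a; b] -> a != b -> odd_at e f v ->
  f a != f b.
Proof.
move=> /setP nv ab [c oc]; apply: contraL oc => /eqP fab.
have [<-|fac] := eqVneq (f a) c.
  rewrite (_ : [set u | _ & _] = [set a; b]) ?cards2 ?ab//.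
  apply/setP => u; have := nv u; rewrite !inE => ->.
  have [->|ua] /= := eqVneq u a; first by rewrite eqxx.
  by case: eqP => // ->; rewrite fab eqxx.
rewrite (_ : [set u | _ & _] = set0) ?cards0//.
apply/setP => u; have := nv u; rewrite !inE => ->.
have [->|ua] /= := eqVneq u a; first by rewrite (negPf fac).
by case: eqP => // ->; rewrite -fab (negPf fac).
Qed.

(** If some color is odd among the other neighbors, it stays odd unless [t] takes it. If none is,
    any color given to [t] becomes odd, and [c0] is arbitrary. *)
Lemma odd_at_recolor e f v t : e v t ->
  exists c0, forall c, c != c0 -> odd_at e (recolor f t c) v.
Proof.
move=> evt; pose others d := [set u | [&& e v u, u != t & f u == d]].
have [/existsP[u ou]|/existsPn none] := boolP [exists u, odd #|others (f u)|].
  exists (f u) => c cu; exists (f u); rewrite (_ : [set w | _ & _] = others (f u))//.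
  apply/setP => w; rewrite !inE /recolor; have [->|wt] /= := eqVneq w t.
    by rewrite (negPf cu) !andbF.
  by [].
exists (f t) => c _; exists c.
rewrite (_ : [set w | _ & _] = t |: others c).
  rewrite cardsU1 !inE eqxx andbF oddD /=.
  have [->|/set0Pn[u]] := eqVneq (others c) set0; first by rewrite cards0.
  by rewrite !inE => /and3P[_ _ /eqP <-]; rewrite (negPf (none u)).
apply/setP => w; rewrite !inE /recolor; have [->|wt] //= := eqVneq w t.
by rewrite evt eqxx.
Qed.

Lemma avoid_colors (L : {fset C}) (s : seq C) : (size s < #|` L|)%N ->
  exists2 c, c \in L & c \notin s.
Proof.
move=> sL; have [/hasP[c cL cs]|/hasPn sub] := boolP (has [pred c | c \notin s] (enum_fset L)).
  by exists c.
have : (size (enum_fset L) <= size s)%N.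
  apply: uniq_leq_size; first exact: fset_uniq.
  by move=> c /sub /=; rewrite negbK.
by move=> /(leq_trans sL); rewrite ltnn.
Qed.
End OddAt.

Definition deg2 (V : finType) (e : rel V) v := #|nbrs e v| == 2.

(* The vertices whose oddness cannot be left to a neighbor of degree 2. *)
Definition even_no2 (V : finType) (e : rel V) v :=
  [&& ~~ odd #|nbrs e v|, 2 < #|nbrs e v| & [forall u, e v u ==> ~~ deg2 e u]].

Definition odd_coloring (V : finType) (C : choiceType) (L : V -> {fset C})
    (e : rel V) (f : V -> C) :=
  [/\ list_coloring L f, Defs.proper e f & forall v, (exists u, e v u) -> odd_at e f v].

(** * Coloring the 2-vertices last *)

Section Extension.
Variables (V : finType) (C : choiceType) (L : V -> {fset C}) (e : rel V).
Hypotheses (L5 : list_assignment 5 L) (e_sym : symmetric e) (e_irr : irreflexive e).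
Implicit Types f : V -> C.

Lemma deg2P v : deg2 e v -> exists a b, [/\ a != b, nbrs e v = [set a; b], e v a & e v b].
Proof.
move=> /cards2P[a [b [ab nv]]]; exists a, b; split=> //.
  by have := set21 a b; rewrite -nv inE.
by have := set22 a b; rewrite -nv inE.
Qed.

Lemma pick_color v (s : seq C) : size s <= 4 -> exists2 c, c \in L v & c \notin s.
Proof. by move=> s4; apply: avoid_colors; rewrite L5. Qed.

Lemma list_coloring_recolor f t c : list_coloring L f -> c \in L t ->
  list_coloring L (recolor f t c).
Proof. by move=> fL cL v; rewrite /recolor; case: eqP => [->|_]. Qed.

Lemma odd_at_recolor_far f v t c : ~~ e v t -> odd_at e f v -> odd_at e (recolor f t c) v.
Proof.
move=> nvt; apply: odd_at_local => // u evu; rewrite recolor_neq//.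
by apply: contraNneq nvt => <-.
Qed.

(* The 2-vertices can be recolored one after the other: each has two neighbors,
   and each neighbor forbids its own color and at most one further color. *)
Lemma recolor_deg2 f :
  (forall u v, e u v -> deg2 e u -> ~~ deg2 e v) ->
  list_coloring L f ->
  (forall u v, e u v -> ~~ deg2 e u -> ~~ deg2 e v -> f u <> f v) ->
  (forall v a b, deg2 e v -> e v a -> e v b -> a != b -> f a <> f b) ->
  (forall v, even_no2 e v -> odd_at e f v) ->
  exists g, odd_coloring L e g.
Proof.
move=> no22 fL f_proper f_two f_even.
suff H (s : seq V) : {in s, forall t, deg2 e t} -> exists g,
    [/\ list_coloring L g, forall u, ~~ deg2 e u -> g u = f u &
      forall t u, t \in s -> e t u -> g t <> g u /\ odd_at e g u].
  have [|g [gL gf gP]] := H (enum (deg2 e)); first by move=> t; rewrite mem_enum.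
  have {}gP t u : deg2 e t -> e t u -> g t <> g u /\ odd_at e g u.
    by move=> t2; apply: gP; rewrite mem_enum.
  exists g; split=> // [u v euv|v [w evw]].
    have [u2|u2] := boolP (deg2 e u); first by case: (gP u v u2 euv).
    have [v2|v2] := boolP (deg2 e v).
      by rewrite e_sym in euv; case: (gP v u v2 euv) => /nesym.
    by rewrite !gf//; apply: f_proper.
  (* Oddness comes from an odd degree, from two differently colored neighbors of a 2-vertex, from a
     2-neighbor recolored to this end, or, for [even_no2], by assumption. *)
  have [|even_v] := boolP (odd #|nbrs e v|); first exact: odd_at_degree.
  have [v2|v2] := boolP (deg2 e v).
    have [a [b [ab nv va vb]]] := deg2P v2.
    apply: (odd_at_two nv ab); apply/eqP.
    by rewrite !gf; [exact: f_two va vb ab|exact: no22 vb v2|exact: no22 va v2].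
  have [/existsP[t /andP[vt t2]]|/existsPn no2] := boolP [exists t, e v t && deg2 e t].
    by rewrite e_sym in vt; case: (gP t v t2 vt).
  have no2v u : e v u -> ~~ deg2 e u by move=> evu; have := no2 u; rewrite evu.
  apply: odd_at_local (f_even v _) => // [u evu|]; first by rewrite gf// no2v.
  apply/and3P; split=> //; last by apply/forallP => u; apply/implyP; apply: no2v.
  have : 0 < #|nbrs e v| by apply/card_gt0P; exists w; rewrite inE.
  by move: even_v v2; rewrite /deg2; case: #|_| => [|[|[|n]]].
elim: s => [_|t s IH s2]; first by exists f.
have [|g [gL gf gP]] := IH; first by move=> u us; apply: s2; rewrite inE us orbT.
have t2 : deg2 e t by apply: s2; rewrite inE eqxx.
have [a [b [ab nt ta tb]]] := deg2P t2.
have [ca caP] := odd_at_recolor g (etrans (e_sym a t) ta).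
have [cb cbP] := odd_at_recolor g (etrans (e_sym b t) tb).
have [|c cL] := @pick_color t [:: g a; g b; ca; cb]; first by [].
rewrite !inE !negb_or => /and4P[cga cgb cca ccb].
have nt' u : e t u -> (u == a) || (u == b).
  by move=> tu; have := in_set2 u a b; rewrite -nt inE tu.
have neq_t u : e t u -> u != t by apply: contraTneq => ->; rewrite e_irr.
have good_t u : e t u -> c <> g u /\ odd_at e (recolor g t c) u.
  by move=> /nt' /orP[] /eqP ->; split; first [exact/eqP|exact: caP|exact: cbP].
exists (recolor g t c); split.
- exact: list_coloring_recolor.
- by move=> u u2; rewrite recolor_neq ?gf//; apply: contraNneq u2 => ->.
- move=> t' u; rewrite inE => t's t'u.
  have [tt'|t't] := eqVneq t' t.
    by rewrite tt' recolor_eq recolor_neq; rewrite tt' in t'u; [exact: good_t|exact: neq_t].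
  rewrite (negPf t't) /= in t's; have [gt' ou] := gP t' u t's t'u.
  have u2 : ~~ deg2 e u by apply: no22 t'u _; apply: s2; rewrite inE t's orbT.
  have ut : u != t by apply: contraNneq u2 => ->.
  rewrite !recolor_neq//; split=> //.
  have [tu|tu] := boolP (e t u); first by case: (good_t u tu).
  by apply: odd_at_recolor_far => //; rewrite e_sym.
Qed.

End Extension.

(** * Reducible configurations *)

Definition del_vertices (V : finType) (e : rel V) (S : {set V}) : rel V :=
  fun u v => [&& e u v, u \notin S & v \notin S].

Section Reducible.
Variables (V : finType) (C : choiceType) (L : V -> {fset C}) (e : rel V).
Hypotheses (L5 : list_assignment 5 L) (e_sym : symmetric e) (e_irr : irreflexive e).
Hypothesis no_C3 : ~ has_cycle e 3.
Hypothesis minimal : forall (S : {set V}) u v, e u v -> u \in S ->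
  exists f, odd_coloring L (del_vertices e S) f.
Hypothesis not_colorable : ~ exists f, odd_coloring L e f.
Local Notation del := (del_vertices e).

Lemma neq_adj u v : e u v -> u != v.
Proof. by apply: contraTneq => ->; rewrite e_irr. Qed.

Lemma nbrsP v u : (u \in nbrs e v) = e v u.
Proof. by rewrite inE. Qed.

Lemma odd_at_del (S : {set V}) f v : odd_coloring L (del S) f -> v \notin S ->
  (forall u, e v u -> u \notin S) -> (exists u, e v u) -> odd_at e f v.
Proof.
move=> [_ _ f_odd] vS far [u evu].
have delv w : del S v w = e v w.
  by rewrite /del_vertices vS; case evw: (e v w) => //=; rewrite far.
by apply: odd_at_local (f_odd v _) => //; exists u; rewrite delv.
Qed.

Lemma proper_del (S : {set V}) f u v : odd_coloring L (del S) f -> u \notin S -> v \notin S ->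
  e u v -> f u <> f v.
Proof. by move=> [_ f_proper _] uS vS euv; apply: f_proper; rewrite /del_vertices euv uS. Qed.

Lemma proper_recolor (f : V -> C) t c :
  (forall a b, e a b -> a != t -> b != t -> f a <> f b) ->
  (forall b, e t b -> c <> f b) -> Defs.proper e (recolor f t c).
Proof.
move=> f_proper cf a b eab; have [at_|at_] := eqVneq a t.
  rewrite at_ in eab *; rewrite recolor_eq recolor_neq; first exact: cf.
  by rewrite eq_sym neq_adj.
rewrite [X in X <> _]recolor_neq//; have [bt|bt] := eqVneq b t.
  by rewrite bt recolor_eq; apply/nesym/cf; rewrite e_sym -bt.
by rewrite recolor_neq//; apply: f_proper.
Qed.

(** A vertex of degree 1 is automatically odd and must avoid two colors only: that of its neighbor
    and the one spoiling the oddness of that neighbor. *)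
Lemma min_degree2 u v : e u v -> 1 < #|nbrs e u|.
Proof.
move=> euv; rewrite ltnNge; apply/negP => du.
have nu w : e u w -> w = v.
  move=> euw; apply/eqP; apply: contraTT du => wv; rewrite -ltnNge.
  apply: leq_trans (subset_leq_card (A := [set w; v]) _); first by rewrite cards2 wv.
  by apply/subsetP => x; rewrite !inE => /orP[] /eqP ->.
have [f fP] := minimal euv (set11 u); apply: not_colorable.
have [fL _ _] := fP.
have evu : e v u by rewrite e_sym.
have [c0 c0P] := odd_at_recolor f evu.
have [|c cL] := @pick_color _ _ _ L5 u [:: f v; c0]; first by [].
rewrite !inE negb_or => /andP[cv cc0].
have vu : v != u by rewrite eq_sym neq_adj.
exists (recolor f u c); split.
- exact: list_coloring_recolor.
- apply: proper_recolor => [a b eab au bu|b /nu ->]; last exact/eqP.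
  by apply: proper_del fP _ _ eab; rewrite inE.
- move=> x [y exy]; have [xu|xu] := eqVneq x u.
    apply: odd_at_degree; rewrite xu (_ : nbrs e u = [set v]) ?cards1//.
    by apply/setP => w; rewrite !inE; apply/idP/eqP => [/nu|->].
  have [xv|xv] := eqVneq x v; first by rewrite xv; apply: c0P.
  have nxu : ~~ e x u by rewrite e_sym; apply: contra xv => /nu ->.
  apply: odd_at_recolor_far => //; apply: odd_at_del fP _ _ _ => //; last by exists y.
    by rewrite inE.
  by move=> w exw; rewrite inE; apply: contraNneq nxu => <-.
Qed.

Lemma deg2_other u v : deg2 e u -> e u v -> exists2 w, w != v & nbrs e u = [set v; w].
Proof.
move=> /deg2P[a [b [ab nu ua ub]]] uv.
have : v \in nbrs e u by rewrite nbrsP.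
rewrite nu !inE => /orP[] /eqP ->; first by exists b; rewrite // eq_sym.
by exists a; rewrite // setUC.
Qed.

(** Let [x] and [y] be the other neighbors of [u] and [v], distinct for lack of triangles. Both
    vertices avoid the colors of [x] and [y]: one choice for properness, the other so that the two
    neighbors of [v], respectively [u], differ. With one color for the oddness of [x] or [y], and
    [c] for [v], at most four of five colors are lost. *)
Lemma no_adjacent_deg2 u v : e u v -> deg2 e u -> ~~ deg2 e v.
Proof.
move=> euv u2; apply/negP => v2.
have evu : e v u by rewrite e_sym.
have [x xv nu] := deg2_other u2 euv; have [y yu nv] := deg2_other v2 evu.
have eux : e u x by rewrite -nbrsP nu set22.
have evy : e v y by rewrite -nbrsP nv set22.
have uv := neq_adj euv; have ux := neq_adj eux; have vy := neq_adj evy.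
have xy : x != y.
  apply/eqP => xy; apply: no_C3; exists [:: u; v; x]; split=> //.
  rewrite /ucycle /= euv {1}xy evy e_sym eux /= !inE !negb_or uv ux.
  by rewrite eq_sym xv.
have [f fP] := minimal euv (set21 u v); apply: not_colorable.
have [fL _ _] := fP.
have exu : e x u by rewrite e_sym.
have eyv : e y v by rewrite e_sym.
have [cx cxP] := odd_at_recolor f exu.
have [|c cL] := @pick_color _ _ _ L5 u [:: f x; f y; cx]; first by [].
rewrite !inE !negb_or => /and3P[cfx cfy ccx].
pose g := recolor f u c.
have [cy cyP] := odd_at_recolor g eyv.
have [|d dL] := @pick_color _ _ _ L5 v [:: f x; f y; cy; c]; first by [].
rewrite !inE !negb_or => /and4P[dfx dfy dcy dc].
have nb_u w : e u w -> w = v \/ w = x by rewrite -nbrsP nu => /set2P.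
have nb_v w : e v w -> w = u \/ w = y by rewrite -nbrsP nv => /set2P.
have gx : g x = f x by rewrite /g recolor_neq// eq_sym.
have gy : g y = f y by rewrite /g recolor_neq.
have gu : g u = c by rewrite /g recolor_eq.
exists (recolor g v d); split.
- by do 2![apply: list_coloring_recolor => //].
- apply: proper_recolor => [a b eab av bv|b /nb_v[] ->]; last 2 first.
  + by rewrite gu; apply/eqP.
  + by rewrite gy; apply/eqP.
  have [au|au] := eqVneq a u.
    rewrite au in eab *; have [bv'|->] := nb_u _ eab; first by rewrite bv' eqxx in bv.
    by rewrite gu gx; apply/eqP.
  have [bu|bu] := eqVneq b u.
    rewrite bu e_sym in eab; have [av'|->] := nb_u _ eab; first by rewrite av' eqxx in av.
    by rewrite bu gu gx; apply/eqP; rewrite eq_sym.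
  rewrite /g !recolor_neq//; apply: proper_del fP _ _ eab; rewrite !inE negb_or.
    by rewrite au av.
  by rewrite bu bv.
- move=> z [w ezw].
  have [zu|zu] := eqVneq z u.
    rewrite zu; apply: (odd_at_two nu); first by rewrite eq_sym.
    by rewrite recolor_eq recolor_neq// gx.
  have [zv|zv] := eqVneq z v.
    rewrite zv; apply: (odd_at_two nv); first by rewrite eq_sym.
    by rewrite !recolor_neq// ?gu ?gy// eq_sym.
  have [zy|zy] := eqVneq z y; first by rewrite zy; apply: cyP.
  have nzv : ~~ e z v by rewrite e_sym; apply/negP => /nb_v[] /eqP; apply/negP.
  apply: odd_at_recolor_far => //.
  have [zx|zx] := eqVneq z x; first by rewrite zx; apply: cxP.
  have nzu : ~~ e z u by rewrite e_sym; apply/negP => /nb_u[] /eqP; apply/negP.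
  apply: odd_at_recolor_far => //; apply: odd_at_del fP _ _ _; last by exists w.
    by rewrite !inE negb_or zu.
  move=> t ezt; rewrite !inE negb_or; apply/andP; split.
    by apply: contraNneq nzu => <-.
  by apply: contraNneq nzv => <-.
Qed.

(** Otherwise delete [u] and its 2-neighbors. At most four colors are then forbidden at [u]: one per
    neighbor, namely its own color or, for a 2-neighbor, that of the vertex behind it, and one more
    per [even_no2] neighbor. The oddness of [u] is free, since it has odd degree or a 2-neighbor. *)
Lemma even_no2_bound u : 2 < #|nbrs e u| -> ~~ even_no2 e u ->
  5 <= #|nbrs e u| + #|[set y in nbrs e u | even_no2 e y]|.
Proof.
move=> u3 nev; rewrite leqNgt; apply/negP; rewrite ltnS => cost.
have nu2 : ~~ deg2 e u by rewrite /deg2; apply: contraTneq u3 => ->.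
have [v0 uv0] : exists v, e u v.
  have : 0 < #|nbrs e u| by apply: leq_trans u3.
  by move=> /card_gt0P[v]; rewrite nbrsP; exists v.
pose S := u |: [set y in nbrs e u | deg2 e y].
have uS : u \in S by rewrite !inE eqxx.
have [f fP] := minimal uv0 uS; apply: not_colorable; have [fL _ f_odd] := fP.
have other_ex y : exists z, deg2 e y -> e u y -> z != u /\ nbrs e y = [set u; z].
  have [y2|] := boolP (deg2 e y); last by exists u.
  have [uy|] := boolP (e u y); last by exists u.
  by have [z zu ny] := deg2_other y2 (etrans (e_sym y u) uy); exists z.
have [other otherP] := fin_all_exists other_ex.
have c0_ex y : exists c0, e u y -> forall c, c != c0 -> odd_at e (recolor f u c) y.
  have [uy|] := boolP (e u y); last by exists (f u).
  by have [c0 c0P] := odd_at_recolor f (etrans (e_sym y u) uy); exists c0.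
have [c0 c0P] := fin_all_exists c0_ex.
pose s := [seq f (if deg2 e y then other y else y) | y <- enum (nbrs e u)] ++
          [seq c0 y | y <- enum [set y in nbrs e u | even_no2 e y]].
have [|c cL] := @pick_color _ _ _ L5 u s.
  by rewrite size_cat !size_map -!cardE.
rewrite mem_cat negb_or => /andP[/mapP cs /mapP cs'].
have c_nb y : e u y -> c <> f (if deg2 e y then other y else y).
  by move=> uy cy; apply: cs; exists y => //; rewrite mem_enum nbrsP.
have c_even y : e u y -> even_no2 e y -> odd_at e (recolor f u c) y.
  move=> uy ey; apply: c0P => //; apply/eqP => cy; apply: cs'; exists y => //.
  by rewrite mem_enum !inE uy.
have notS y : ~~ deg2 e y -> y != u -> y \notin S.
  by move=> y2 yu; rewrite !inE negb_or yu negb_and y2 orbT.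
apply: (@recolor_deg2 _ _ _ _ L5 e_sym e_irr (recolor f u c)).
- exact: no_adjacent_deg2.
- exact: list_coloring_recolor.
- move=> a b eab a2 b2; have [au|au] := eqVneq a u.
    rewrite au recolor_eq recolor_neq; last by rewrite eq_sym -au neq_adj.
    by rewrite au in eab; have := c_nb b eab; rewrite (negPf b2).
  have [bu|bu] := eqVneq b u.
    rewrite bu recolor_eq recolor_neq//; apply/nesym.
    by rewrite bu e_sym in eab; have := c_nb a eab; rewrite (negPf a2).
  by rewrite !recolor_neq//; apply: proper_del fP _ _ eab; apply: notS.
- move=> v a b v2 va vb ab.
  have a2 := no_adjacent_deg2 va v2; have b2 := no_adjacent_deg2 vb v2.
  have [uv|uv] := boolP (e u v).
    have [zu nv] := otherP v v2 uv; have := c_nb v uv; rewrite v2 => cz.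
    have : a \in nbrs e v by rewrite nbrsP.
    have : b \in nbrs e v by rewrite nbrsP.
    rewrite nv !inE => /orP[] /eqP bE /orP[] /eqP aE; move: ab; rewrite aE bE ?eqxx// => _.
      by rewrite recolor_eq recolor_neq//; apply/nesym.
    by rewrite recolor_eq recolor_neq.
  have neq w : e v w -> w != u by move=> vw; apply: contraNneq uv => <-; rewrite e_sym.
  rewrite !recolor_neq ?neq//; apply/eqP.
  have [a' [b' [ab' nv _ _]]] := deg2P v2.
  have vS : v \notin S.
    rewrite !inE negb_or (negPf uv) andbT.
    by apply: contraNneq nu2 => <-.
  (* A 2-vertex not adjacent to [u] keeps its neighborhood in the deleted graph, where its oddness
     means that its two neighbors differ. *)
  have /(odd_at_two_neq nv ab') fab : odd_at e f v.
    apply: odd_at_del fP vS _ _; last by exists a.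
    by move=> w vw; apply: notS (neq w vw); apply: no_adjacent_deg2 vw v2.
  have : a \in nbrs e v by rewrite nbrsP.
  have : b \in nbrs e v by rewrite nbrsP.
  rewrite nv !inE => /orP[] /eqP bE /orP[] /eqP aE; move: ab; rewrite aE bE ?eqxx// => _.
  by rewrite eq_sym.
- move=> v ev; have [uv|uv] := boolP (e u v); first exact: c_even.
  have /and3P[_ v3 /forallP no2] := ev.
  have v_u : v != u by apply: contraNneq nev => <-.
  apply: odd_at_recolor_far; first by rewrite e_sym.
  apply: odd_at_del fP _ _ _.
  + by apply: notS => //; rewrite /deg2; apply: contraTneq v3 => ->.
  + move=> w vw; apply: notS; first by have := no2 w; rewrite vw.
    by apply: contraNneq uv => <-; rewrite e_sym.
  + have : 0 < #|nbrs e v| by apply: leq_trans v3.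
    by move=> /card_gt0P[w]; rewrite nbrsP; exists w.
Qed.
End Reducible.

(** * Discharging *)

Section EdgeCounts.
Variables (V : finType) (e : rel V).
Hypotheses (e_sym : symmetric e) (e_irr : irreflexive e).

Lemma card_edges_at (S : {set {set V}}) v : S \subset edge_set e ->
  #|[set y in nbrs e v | [set v; y] \in S]| = #|[set B in S | v \in B]|.
Proof.
move=> /subsetP Se; rewrite -(card_in_imset (f := fun y => [set v; y])); last first.
  move=> y z; rewrite !inE => /andP[vy _] /andP[vz _] /set2_eq[[]//|[<- //]].
apply: eq_card => B; rewrite [RHS]inE; apply/imsetP/andP => [[y]|[BS vB]].
  by rewrite !inE => /andP[_ yS] ->; rewrite set21.
have /edge_setP[a [b [eab BE]]] := Se _ BS.
move: vB BS; rewrite BE !inE => /orP[] /eqP -> BS.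
  by exists b => //; rewrite !inE eab.
by exists a; [rewrite !inE e_sym eab setUC|exact: setUC].
Qed.

Lemma handshake : \sum_v #|nbrs e v| = 2 * #|edge_set e|.
Proof.
transitivity (\sum_v #|[set B in edge_set e | v \in B]|).
  apply: eq_bigr => v _; rewrite -card_edges_at//; apply: eq_card => y.
  by rewrite [RHS]in_set edge_set2// nbrsP andbb.
under eq_bigr => v _ do rewrite -sum1_card.
rewrite (exchange_big_dep (mem (edge_set e))) /=; last by move=> v B _; rewrite inE => /andP[].
rewrite mulnC -sum_nat_const; apply: eq_bigr => B BE.
rewrite (eq_bigl (mem B)); last by move=> v; rewrite in_set BE.
rewrite sum1_card; have /edge_setP[a [b [eab BE']]] := BE.
rewrite BE' cards2; case: eqP => // ab.
by move: eab; rewrite ab e_irr.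
Qed.

Lemma coverP v : reflect (exists u, e v u) (v \in cover (edge_set e)).
Proof.
apply: (iffP bigcupP) => [[B /edge_setP[a [b [eab ->]]]]|[u evu]].
  by move=> /set2P[] ->; [exists b|exists a; rewrite e_sym].
by exists [set v; u]; rewrite ?set21//; apply/edge_setP; exists v, u.
Qed.

Hypothesis C5_disjoint : forall A B, A \in five_cycles e -> B \in five_cycles e ->
  A != B -> [disjoint A & B].

Lemma five_cycles_trivIset : trivIset (five_cycles e).
Proof. by apply/trivIsetP. Qed.

Lemma five_cycle_edges A : A \in five_cycles e -> A \subset edge_set e.
Proof.
move=> /five_cyclesP[c [/andP[ec _] _] ->]; apply/subsetP => B /imsetP[x xc ->].
by rewrite edge_set2//; apply: next_cycle.
Qed.

(** The 5-cycles being edge-disjoint, these edges are counted cycle by cycle, two for each cycle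
    through [v]. *)
Lemma even_five_cycle_nbrs v :
  ~~ odd #|[set y in nbrs e v | [set v; y] \in cover (five_cycles e)]|.
Proof.
rewrite card_edges_at; last by apply/bigcupsP => A /five_cycle_edges.
rewrite -sum1_card (eq_bigl (fun B => (B \in cover (five_cycles e)) && (v \in B))).
  rewrite big_trivIset_cond ?five_cycles_trivIset// /=.
  elim/big_ind: _ => // [m n|A A5]; first by rewrite oddD => /negPf -> /negPf ->.
  rewrite (eq_bigl [in [set B in A | v \in B]]); last by move=> B; rewrite !inE.
  rewrite sum1_card; have /five_cyclesP[c [/andP[_ uc] sc] ->] := A5.
  by rewrite card_cycle_edges_at ?sc// oddM andbF.
by move=> B; rewrite in_set.
Qed.
End EdgeCounts.

Section Discharging.
Variables (V : finType) (e : rel V).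

(* In units of 1/5, a vertex of degree d starts with charge 125 d - 350 and every
   5-cycle with -100.  Along a dart (x, y), x sends dart_give x y to y and
   dart_pay x y to the 5-cycle containing the edge, if any; the constants make all
   final charges nonnegative, with 0 only possible at 5-cycles and 2-vertices. *)
Definition dart_pay x y : nat :=
  if deg2 e x then 0 else
  if even_no2 e x then (if even_no2 e y then 35 else 10) else
  if deg2 e y || even_no2 e y then 6 else 38.

Definition dart_give x y : nat :=
  if deg2 e x then 0 else
  if deg2 e y then 50 else
  if even_no2 e x && ~~ even_no2 e y then 25 else 0.

Lemma even_no2_deg2 x : even_no2 e x -> ~~ deg2 e x.
Proof. by move=> /and3P[_ x3 _]; rewrite /deg2; apply: contraTneq x3 => ->. Qed.

Hypotheses (e_sym : symmetric e) (e_irr : irreflexive e).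
Hypothesis min_degree : forall u v, e u v -> 1 < #|nbrs e u|.
Hypothesis no22 : forall u v, e u v -> deg2 e u -> ~~ deg2 e v.
Hypothesis bound : forall u, 2 < #|nbrs e u| -> ~~ even_no2 e u ->
  5 <= #|nbrs e u| + #|[set y in nbrs e u | even_no2 e y]|.
Hypothesis C5_disjoint : forall A B, A \in five_cycles e -> B \in five_cycles e ->
  A != B -> [disjoint A & B].

Local Notation U5 := (cover (five_cycles e)).

Lemma deg2_nbr x y : e x y -> deg2 e x -> ~~ deg2 e y /\ ~~ even_no2 e y.
Proof.
move=> exy x2; split; first exact: no22 exy x2.
apply/negP => /and3P[_ _ /forallP/(_ x)]; by rewrite e_sym exy x2.
Qed.

(** Call a vertex ordinary if it is neither [deg2] nor [even_no2]. As 5 is odd and 2-vertices have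
    only ordinary neighbors, some edge joins two ordinary vertices, yielding 76, or two [even_no2]
    vertices, yielding 70. Edges from an ordinary vertex yield 6 towards a 2-vertex and 16 towards
    an [even_no2] one. The minimum 76 + 4 * 6 = 100 occurs with two 2-vertices. *)
Lemma pentagon_pay (a b c d f : V) :
  e a b -> e b c -> e c d -> e d f -> e f a ->
  100 <= dart_pay a b + dart_pay b a + (dart_pay b c + dart_pay c b) +
    (dart_pay c d + dart_pay d c) + (dart_pay d f + dart_pay f d) +
    (dart_pay f a + dart_pay a f).
Proof.
have type x y : e x y -> [/\ (deg2 e x ==> ~~ deg2 e y && ~~ even_no2 e y),
    (deg2 e y ==> ~~ deg2 e x && ~~ even_no2 e x),
    (even_no2 e x ==> ~~ deg2 e x) & (even_no2 e y ==> ~~ deg2 e y)].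
  move=> exy; have eyx : e y x by rewrite e_sym.
  split; apply/implyP; try exact: even_no2_deg2.
    by move=> /(deg2_nbr exy)[-> ->].
  by move=> /(deg2_nbr eyx)[-> ->].
move=> /type[h1 h2 h3 h4] /type[h5 h6 h7 h8] /type[h9 h10 h11 h12].
move=> /type[h13 h14 h15 h16] /type[h17 h18 h19 h20].
rewrite /dart_pay; move: h1 h2 h3 h4 h5 h6 h8 h9 h10 h12 h13 h14 h16 h17 h18.
clear.
case: (deg2 e a) => /=; case: (even_no2 e a) => //=;
case: (deg2 e b) => //=; case: (even_no2 e b) => //=;
case: (deg2 e c) => //=; case: (even_no2 e c) => //=;
case: (deg2 e d) => //=; case: (even_no2 e d) => //=;
case: (deg2 e f) => //=; case: (even_no2 e f) => //=.
Qed.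
Definition paid x y := if [set x; y] \in U5 then dart_pay x y else 0.

(** The deficit 350 - 2 * 125 = 100 is covered exactly by 50 from each neighbor. *)
Lemma deg2_balance v : deg2 e v ->
  350 + \sum_(y in nbrs e v) (dart_give v y + paid v y) =
  \sum_(y in nbrs e v) (125 + dart_give y v).
Proof.
move=> v2; rewrite big1 => [|y]; last first.
  by rewrite /paid /dart_give /dart_pay v2 if_same.
rewrite (eq_bigr (fun => 175)).
  by rewrite sum_nat_const; have /eqP -> := v2.
move=> y; rewrite nbrsP => vy; have [y2 _] := deg2_nbr vy v2.
by rewrite /dart_give v2 (negPf y2).
Qed.

(** Each dart costs at most 35: either 35 paid, or 25 given and 10 paid. Degree d leaves 90 d - 350,
    positive from d = 4 on. *)
Lemma even_balance v : even_no2 e v ->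
  350 + \sum_(y in nbrs e v) (dart_give v y + paid v y) <
  \sum_(y in nbrs e v) (125 + dart_give y v).
Proof.
move=> ve; have /and3P[ev v3 _] := ve; have v2 := even_no2_deg2 ve.
have v4 : 4 <= #|nbrs e v| by move: ev v3; case: #|_| => [|[|[|[|n]]]].
apply: (@leq_trans (\sum_(y in nbrs e v) 125)); last first.
  by apply: leq_sum => y _; apply: leq_addr.
apply: (@leq_ltn_trans (350 + \sum_(y in nbrs e v) 35)).
  rewrite leq_add2l; apply: leq_sum => y; rewrite nbrsP => vy.
  have y2 : ~~ deg2 e y.
    by apply/negP => y2; rewrite e_sym in vy; have [_] := deg2_nbr vy y2; rewrite ve.
  rewrite /paid /dart_give /dart_pay (negPf v2) (negPf y2) ve /=.
  by case: (even_no2 e y); case: (_ \in U5).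
rewrite !sum_nat_const; lia.
Qed.

(** A dart nets at least 125 - 50 - 6 = 69 towards a 2-vertex, 125 + 25 - 6 = 144 towards an
    [even_no2] vertex and 125 - 38 = 87 otherwise. By [bound], degree 3 brings at least 69 + 2 * 144
    = 357 and degree 4 at least 3 * 69 + 144 = 351; degree 6 brings 414. Degree 5 falls short of 350
    only with five 2-neighbors, where [parity] supplies the missing 6. *)
Lemma normal_balance v : 2 < #|nbrs e v| -> ~~ even_no2 e v ->
  350 + \sum_(y in nbrs e v) (dart_give v y + paid v y) <
  \sum_(y in nbrs e v) (125 + dart_give y v).
Proof.
move=> v3 ve; have := bound v3 ve.
have v2 : ~~ deg2 e v by rewrite /deg2; apply: contraTneq v3 => ->.
pose gain y := 69 + 75 * even_no2 e y + 18 * (~~ even_no2 e y && ~~ deg2 e y) +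
  6 * (deg2 e y && ([set v; y] \notin U5)).
have step : \sum_(y in nbrs e v) (dart_give v y + paid v y) + \sum_(y in nbrs e v) gain y <=
    \sum_(y in nbrs e v) (125 + dart_give y v).
  rewrite -big_split; apply: leq_sum => y _ /=.
  rewrite /gain /paid /dart_give /dart_pay (negPf v2) (negPf ve) /=.
  have [ey|ey] := boolP (even_no2 e y).
    by rewrite (negPf (even_no2_deg2 ey)) /=; case: (_ \in U5).
  by case: (deg2 e y); case: (_ \in U5).
have count (P : pred V) k : \sum_(y in nbrs e v) k * P y = k * #|[set y in nbrs e v | P y]|.
  rewrite -big_distrr /=; congr (_ * _).
  rewrite -sum1_card [RHS](eq_bigl (fun y => (y \in nbrs e v) && P y)); last first.
    by move=> y; rewrite in_set.
  by rewrite [RHS]big_mkcondr; apply: eq_bigr => y _; case: (P y).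
have gainE : \sum_(y in nbrs e v) gain y = 69 * #|nbrs e v| +
    75 * #|[set y in nbrs e v | even_no2 e y]| +
    18 * #|[set y in nbrs e v | ~~ even_no2 e y && ~~ deg2 e y]| +
    6 * #|[set y in nbrs e v | deg2 e y && ([set v; y] \notin U5)]|.
  rewrite /gain 3!big_split sum_nat_const (count (even_no2 e)).
  rewrite (count (fun y => ~~ even_no2 e y && ~~ deg2 e y)).
  by rewrite (count (fun y => deg2 e y && ([set v; y] \notin U5))) mulnC.
rewrite gainE in step.
set E := #|[set y in nbrs e v | even_no2 e y]| in step *.
set N := #|[set y in nbrs e v | ~~ even_no2 e y && _]| in step.
set Z := #|[set y in nbrs e v | deg2 e y && _]| in step.
have parity : #|nbrs e v| = 5 -> E = 0 -> N = 0 -> 0 < Z.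
  move=> d5 E0 N0; rewrite lt0n; apply/negP => /eqP Z0.
  (* five 2-neighbors exceed the budget by 5, but one edge is in no 5-cycle *)
  have := even_five_cycle_nbrs e_sym C5_disjoint v.
  rewrite (_ : [set _ in _ | _] = nbrs e v) ?d5//.
  apply/setP => y; rewrite in_set; case vy: (y \in nbrs e v) => //=.
  have none (P : pred V) : #|[set y in nbrs e v | P y]| = 0 -> ~~ P y.
    by move=> /eqP; rewrite cards_eq0 => /eqP/setP/(_ y); rewrite in_set vy in_set0 /= => ->.
  have nE := none _ E0; have := none _ N0; have := none _ Z0.
  by rewrite nE /= negbK => + y2; rewrite y2 /= negbK.
move: step v3 parity; set S1 := \sum_(y in _) _; set S2 := \sum_(y in _) _.
move: #|_| => d; lia.
Qed.

Lemma pentagon_total A : A \in five_cycles e ->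
  100 <= \sum_v \sum_(y in nbrs e v | [set v; y] \in A) dart_pay v y.
Proof.
move=> /five_cyclesP[c [/andP[ec uc] sc] ->].
case: c sc ec uc => [|a [|b [|c [|d [|f [|? ?]]]]]] // _ ec uc.
pose s := [:: a; b; c; d; f].
have /= := ec; rewrite andbT => /and5P[ab bc cd df fa].
apply: leq_trans (pentagon_pay ab bc cd df fa) _.
rewrite pair_big_dep /=.
(* The ten darts of the pentagon are listed by positions, so that their distinctness reduces to that
   of the vertices. *)
pose idx := [:: (0,1); (1,0); (1,2); (2,1); (2,3); (3,2); (3,4); (4,3); (4,0); (0,4)].
pose t := [seq (nth a s p.1, nth a s p.2) | p <- idx].
have ut : uniq t.
  rewrite map_inj_in_uniq//.
  have lt5 : all (fun p => (p.1 < 5) && (p.2 < 5)) idx by [].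
  move=> [i j] [i' j'] /(allP lt5)/andP[/= i5 j5] /(allP lt5)/andP[/= i5' j5'] [h1 h2].
  congr pair; apply/eqP; first by rewrite -(@nth_uniq _ a s _ _ i5 i5' uc) h1.
  by rewrite -(@nth_uniq _ a s _ _ j5 j5' uc) h2.
rewrite (_ : _ + _ = \sum_(p <- t) dart_pay p.1 p.2); last first.
  by rewrite /t /idx /= !big_cons big_nil /= addn0 !addnA.
rewrite big_uniq//= big_mkcond [X in _ <= X]big_mkcond; apply: leq_sum => p _.
case: ifP => // pt; rewrite (_ : _ && _) //.
have in_c x y : x \in s -> next s x = y -> [set x; y] \in cycle_edges s.
  by move=> xs <-; apply/imsetP; exists x.
have nx x : x \in s -> e x (next s x) by apply: next_cycle.
have nth_next i : i < 5 -> next s (nth a s i) = nth a s (i.+1 %% 5).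
  by move=> i5; rewrite next_nth mem_nth// index_uniq//; case: i i5 => [|[|[|[|[|]]]]].
have arc i : i < 5 -> e (nth a s i) (nth a s (i.+1 %% 5)) /\
    [set nth a s i; nth a s (i.+1 %% 5)] \in cycle_edges s.
  by move=> i5; rewrite -nth_next//; split; [apply: nx|apply: in_c]; rewrite ?mem_nth.
have cra i : i < 5 -> e (nth a s (i.+1 %% 5)) (nth a s i) /\
    [set nth a s (i.+1 %% 5); nth a s i] \in cycle_edges s.
  by move=> /arc[? ?]; rewrite e_sym setUC.
apply/andP; rewrite nbrsP.
move: pt; rewrite /t /idx /= !inE.
by do 9?[case/orP]; move=> /eqP -> /=;
  first [exact: (arc 0)|exact: (cra 0)|exact: (arc 1)|exact: (cra 1)|exact: (arc 2)
        |exact: (cra 2)|exact: (arc 3)|exact: (cra 3)|exact: (arc 4)|exact: (cra 4)].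
Qed.

Lemma five_cycles_paid :
  100 * #|five_cycles e| <= \sum_v \sum_(y in nbrs e v) paid v y.
Proof.
rewrite mulnC -sum_nat_const.
apply: (@leq_trans (\sum_(A in five_cycles e)
    \sum_v \sum_(y in nbrs e v | [set v; y] \in A) dart_pay v y)).
  by apply: leq_sum => A; apply: pentagon_total.
rewrite exchange_big /=; apply: leq_sum => v _.
under eq_bigr => A _ do rewrite big_mkcondr /=.
rewrite exchange_big /=; apply: leq_sum => y _; rewrite /paid.
case: ifPn => [/bigcupP[A A5 yA]|nU].
  rewrite (bigD1 A)//= yA big1 ?addn0// => B /andP[B5 BA].
  case: ifP => // yB; have /pred0P/(_ [set v; y]) := C5_disjoint B5 A5 BA.
  by rewrite /= yB yA.
rewrite big1// => A A5; case: ifP => // yA.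
by case/negP: nU; apply/bigcupP; exists A.
Qed.

Lemma discharging u v : e u v ->
  7 * #|cover (edge_set e)| + 2 * #|five_cycles e| < 5 * #|edge_set e|.
Proof.
move=> euv; set W := cover (edge_set e).
have WP x : reflect (exists y, e x y) (x \in W) := coverP e_sym x.
pose inflow x := \sum_(y in nbrs e x) (125 + dart_give y x).
pose outflow x := \sum_(y in nbrs e x) (dart_give x y + paid x y).
have strict x : x \in W -> ~~ deg2 e x -> 350 + outflow x < inflow x.
  move=> /WP[y exy] x2; have [xe|xe] := boolP (even_no2 e x); first exact: even_balance.
  apply: normal_balance => //; have := min_degree exy; move: x2; rewrite /deg2.
  by case: #|_| => [|[|[|n]]].
have weak x : x \in W -> 350 + outflow x <= inflow x.
  have [x2 _|x2 xW] := boolP (deg2 e x); first by rewrite [X in X <= _]deg2_balance.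
  exact/ltnW/strict.
(* One end of the edge is not a 2-vertex; its strict balance makes the total strict. *)
have [w wW w2] : exists2 w, w \in W & ~~ deg2 e w.
  have [u2|u2] := boolP (deg2 e u).
    by exists v; [apply/WP; exists u; rewrite e_sym|exact: no22 euv u2].
  by exists u => //; apply/WP; exists v.
have total : 350 * #|W| + \sum_(x in W) outflow x < \sum_(x in W) inflow x.
  rewrite mulnC -sum_nat_const -big_split (bigD1 w)//= [X in _ < X](bigD1 w)//=.
  rewrite -addSn; apply: leq_add; first exact: strict.
  by apply: leq_sum => x /andP[xW _]; apply: weak.
have restrictW (F : V -> V -> nat) :
    \sum_(x in W) \sum_(y in nbrs e x) F x y = \sum_x \sum_(y in nbrs e x) F x y.
  rewrite [RHS](bigID (mem W)) /= [X in _ + X]big1 ?addn0// => x xW.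
  by apply: big1 => y; rewrite nbrsP => exy; case/negP: xW; apply/WP; exists y.
rewrite /outflow /inflow !restrictW in total.
have swap : \sum_x \sum_(y in nbrs e x) dart_give y x =
    \sum_x \sum_(y in nbrs e x) dart_give x y.
  rewrite (exchange_big_dep predT)//=; apply: eq_bigr => x _.
  by apply: eq_bigl => y; rewrite !nbrsP e_sym.
have splitL : \sum_x \sum_(y in nbrs e x) (dart_give x y + paid x y) =
    \sum_x \sum_(y in nbrs e x) dart_give x y + \sum_x \sum_(y in nbrs e x) paid x y.
  by rewrite -big_split; apply: eq_bigr => x _; rewrite big_split.
have splitR : \sum_x \sum_(y in nbrs e x) (125 + dart_give y x) =
    250 * #|edge_set e| + \sum_x \sum_(y in nbrs e x) dart_give x y.
  rewrite -swap (_ : 250 * _ = \sum_x \sum_(y in nbrs e x) 125).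
    by rewrite -big_split; apply: eq_bigr => x _; rewrite big_split.
  under eq_bigr => x _ do rewrite sum_nat_const.
  by rewrite -big_distrl /= handshake// mulnAC.
have paid5 := five_cycles_paid.
rewrite splitL splitR in total.
move: total paid5.
have arith (a b c d f : nat) : 350 * a + (b + c) < 250 * d + b -> 100 * f <= c ->
  7 * a + 2 * f < 5 * d by lia.
exact: arith.
Qed.

End Discharging.

(** * Grid minors are odd 5-choosable *)

Section DeleteVertices.
Variables (V : finType) (e : rel V) (S : {set V}).
Local Notation del := (del_vertices e S).

Lemma del_sub : subrel del e.
Proof. by move=> u v /and3P[]. Qed.

Lemma del_sym : symmetric e -> symmetric del.
Proof. by move=> e_sym u v; rewrite /del_vertices e_sym [(u \notin S) && _]andbC. Qed.

Lemma del_irr : irreflexive e -> irreflexive del.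
Proof. by move=> e_irr u; rewrite /del_vertices e_irr. Qed.

Lemma del_is_cycle k c : is_cycle del k c -> is_cycle e k c.
Proof.
move=> [/andP[ec uc] sc]; split=> //; apply/andP; split=> //.
exact: sub_cycle del_sub _ ec.
Qed.

Lemma del_grid_minor : grid_minor e -> grid_minor del.
Proof.
move=> [Y [E [N [T [br [grid disj conn edge]]]]]]; exists Y, E, N, T, br.
by split=> // u v /del_sub; apply: edge.
Qed.

Lemma card_del_edges u v : symmetric e -> e u v -> u \in S ->
  #|edge_set del| < #|edge_set e|.
Proof.
move=> e_sym euv uS; apply: proper_card; apply/properP; split.
  apply/subsetP => A /edge_setP[x [y [exy ->]]]; rewrite edge_set2//.
  exact: del_sub exy.
exists [set u; v]; first by rewrite edge_set2.
by rewrite edge_set2 /del_vertices ?uS ?andbF//; apply: del_sym.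
Qed.
End DeleteVertices.

(** Every neighbor [y] of [x] has a further neighbor [z y]. Without triangles it is not adjacent to
    [x], without 4-cycles [z] is injective, so there are at least 1 + 2 d vertices. *)
Lemma card_second_nbrs (V : finType) (e : rel V) x :
  symmetric e -> irreflexive e -> ~ has_cycle e 3 -> ~ has_cycle e 4 ->
  (forall u v, e u v -> 1 < #|nbrs e u|) -> (exists y, e x y) ->
  (#|nbrs e x|).*2 < #|cover (edge_set e)|.
Proof.
move=> e_sym e_irr C3 C4 deg [y0 xy0].
pose z y := odflt x [pick w | e y w && (w != x)].
have zP y : e x y -> e y (z y) /\ z y != x.
  move=> xy; have yx : e y x by rewrite e_sym.
  rewrite /z; case: pickP => [w /andP[]//|none]; exfalso.
  have := deg _ _ yx; rewrite ltnNge => /negP; apply.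
  rewrite -(cards1 x); apply/subset_leq_card/subsetP => w; rewrite !inE => yw.
  by have := none w; rewrite yw /= => /negbFE.
have neq a b : e a b -> a != b by apply: contraTneq => ->; rewrite e_irr.
have nz y : e x y -> ~~ e x (z y).
  move=> xy; apply/negP => xz; have [yz zx] := zP y xy.
  apply: C3; exists [:: x; y; z y]; split=> //.
  by rewrite /ucycle /= xy yz e_sym xz /= !inE !negb_or (neq _ _ xy) (neq _ _ yz) eq_sym zx.
have z_inj : {in nbrs e x &, injective z}.
  move=> y y'; rewrite !nbrsP => xy xy' zz; apply/eqP; apply/negPn/negP => yy'.
  have [yz zx] := zP y xy; have [yz' _] := zP y' xy'.
  apply: C4; exists [:: x; y; z y; y']; split=> //.
  rewrite /ucycle /= xy yz zz e_sym yz' e_sym xy' /= !inE !negb_or.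
  rewrite (neq _ _ xy) (neq _ _ xy') yy' -zz (neq _ _ yz) [x == z y]eq_sym zx zz.
  by rewrite eq_sym (neq _ _ yz').
have sub : x |: (nbrs e x :|: z @: nbrs e x) \subset cover (edge_set e).
  apply/subsetP => w /setU1P[->|/setUP[]]; first by apply/(coverP e_sym); exists y0.
    by rewrite nbrsP => xw; apply/(coverP e_sym); exists x; rewrite e_sym.
  move=> /imsetP[y + ->]; rewrite nbrsP => xy; apply/(coverP e_sym).
  by have [yz _] := zP y xy; exists y; rewrite e_sym.
apply: leq_trans (subset_leq_card sub).
rewrite cardsU1 cardsU card_in_imset//.
have -> : nbrs e x :&: z @: nbrs e x = set0.
  apply/setP => w; rewrite in_set0 in_setI nbrsP; apply/negP => /andP[xw /imsetP[y]].
  by rewrite nbrsP => /nz + wz; rewrite -wz xw.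
rewrite cards0 subn0 addnn (_ : x \notin _) //.
rewrite in_setU negb_or nbrsP e_irr; apply/imsetP => -[y]; rewrite nbrsP => xy xz.
by have [_] := zP y xy; rewrite -xz eqxx.
Qed.

Lemma minor_odd_choosable (V : finType) (e : rel V) :
  symmetric e -> irreflexive e -> grid_minor e ->
  ~ has_cycle e 3 -> ~ has_cycle e 4 -> ~ has_cycle e 6 ->
  (forall c1 c2, is_cycle e 5 c1 -> is_cycle e 5 c2 ->
     cycle_edges c1 <> cycle_edges c2 -> [disjoint cycle_edges c1 & cycle_edges c2]) ->
  odd_choosable e 5.
Proof.
move=> e_sym e_irr e_minor C3 C4 C6 C5 C L L5.
suff [f [? ? ?]] : exists f, odd_coloring L e f by exists f.
have [n le_n] := ubnP #|edge_set e|.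
elim: n => // n IH in e e_sym e_irr e_minor C3 C4 C6 C5 le_n *.
apply: boolp.contrapT => not_colorable.
have C5' A B : A \in five_cycles e -> B \in five_cycles e -> A != B -> [disjoint A & B].
  move=> /five_cyclesP[c1 c1P ->] /five_cyclesP[c2 c2P ->] /eqP; exact: C5.
have minimal (S : {set V}) u v : e u v -> u \in S ->
    exists f, odd_coloring L (del_vertices e S) f.
  move=> euv uS; apply: IH.
  - exact: del_sym.
  - exact: del_irr.
  - exact: del_grid_minor.
  - by move=> [c /del_is_cycle cP]; apply: C3; exists c.
  - by move=> [c /del_is_cycle cP]; apply: C4; exists c.
  - by move=> [c /del_is_cycle cP]; apply: C6; exists c.
  - by move=> c1 c2 /del_is_cycle ? /del_is_cycle ?; apply: C5.
  - exact: leq_trans (card_del_edges e_sym euv uS) _.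
have [/existsP[u /existsP[v euv]]|/existsPn none] := boolP [exists u, exists v, e u v];
    last first.
  have no_edge u v : ~~ e u v by have /existsPn := none u.
  have [|f fL] := @fin_all_exists V (fun=> C) (fun v c => c \in L v).
    by move=> v; have [c cL _] := pick_color L5 v (s := [::]) isT; exists c.
  apply: not_colorable; exists f; split=> // [u v euv|v [u evu]].
    by have := no_edge u v; rewrite euv.
  by have := no_edge v u; rewrite evu.
have deg := min_degree2 L5 e_sym e_irr minimal not_colorable.
have no22 := no_adjacent_deg2 L5 e_sym e_irr C3 minimal not_colorable.
have bound := even_no2_bound L5 e_sym e_irr C3 minimal not_colorable.
have sparse := discharging e_sym e_irr deg no22 bound C5' euv.
have nonempty : edge_set e != set0 by apply/set0Pn; exists [set u; v]; rewrite edge_set2.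
(* If the vertex [w] has degree 3, then [bound] gives it an [even_no2] neighbor, of degree at least
   4. *)
have [x xW x4] : exists2 x, (exists y, e x y) & 3 < #|nbrs e x|.
  have [w [y wy] w2] : exists2 w, (exists y, e w y) & ~~ deg2 e w.
    have [u2|u2] := boolP (deg2 e u); last by exists u => //; exists v.
    by exists v; [exists u; rewrite e_sym|exact: no22 euv u2].
  have w3 : 2 < #|nbrs e w|.
    by have := deg _ _ wy; move: w2; rewrite /deg2; case: #|_| => [|[|[|]]].
  have [w4|w4] := ltnP 3 #|nbrs e w|; first by exists w => //; exists y.
  have even4 x : even_no2 e x -> 3 < #|nbrs e x|.
    by move=> /and3P[ev x3 _]; move: ev x3; case: #|_| => [|[|[|[|]]]].
  have [we|we] := boolP (even_no2 e w); first by exists w; [exists y|exact: even4].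
  have /card_gt0P[x] : 0 < #|[set y in nbrs e w | even_no2 e y]|.
    by have := bound w w3 we; move: w3 w4; lia.
  rewrite !inE => /andP[wx xe]; exists x; last exact: even4.
  by exists w; rewrite e_sym.
have big := card_second_nbrs e_sym e_irr C3 C4 deg xW.
have := grid_minor_sparse e_sym e_irr e_minor C3 C4 C6 C5' nonempty.
(* The main inequality contradicts discharging at once. In the degenerate case [7 * W < 5 * E] and
   [4 * E <= 5 * W + 5] leave at most 8 vertices, but a vertex of degree 4 requires 9. *)
move: sparse big x4; move: #|cover _| #|five_cycles _| #|edge_set _| #|nbrs _ _|.
by move=> W t E d; lia.
Qed.

From mathcomp Require Import generic_quotient.
From mathcomp Require Import boolp classical_sets set_interval.
From mathcomp Require Import topology normedtype.
Import numFieldNormedType.Exports.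
Local Open Scope ring_scope.

(** * The quotient of the plane *)

Lemma plane_signE k m : plane_sign k m = (-1) ^+ (k && odd `|m|).
Proof.
case: k; rewrite /plane_sign //= signr_odd; case: m => n //.
Qed.

Section Closeness.
Local Open Scope classical_set_scope.
Local Open Scope quotient_scope.
Variables (R : realType) (k : bool).

Let X : topologicalType := quotient_topology {eq_quot (plane_equiv R k)}.
Definition proj_plane (a : R * R) : X := \pi_{eq_quot (plane_equiv R k)} a.
Local Notation pi := proj_plane.

Lemma proj_planeP a b : pi a = pi b <-> plane_orbit k a b.
Proof.
rewrite /pi; split.
  by move=> /eqmodP /asboolP.
by move=> h; apply/eqmodP/asboolP.
Qed.

Lemma proj_plane_surj x : exists a, pi a = x.
Proof. by exists (repr x); rewrite /pi reprK. Qed.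

Definition near_plane (d : R) (a b : R * R) :=
  `|a.1 - b.1| < d /\ `|a.2 - b.2| < d.

Lemma near_plane_sym d a b : near_plane d a b -> near_plane d b a.
Proof. by case=> h1 h2; split; rewrite distrC. Qed.

Lemma near_plane_trans d d' a b c :
  near_plane d a b -> near_plane d' b c -> near_plane (d + d') a c.
Proof.
case=> h1 h2 [h3 h4]; split.
  by rewrite (le_lt_trans (ler_distD b.1 _ _))// ltrD.
by rewrite (le_lt_trans (ler_distD b.2 _ _))// ltrD.
Qed.

(** Closeness in the quotient of the sup metric of the plane. *)
Definition nearby (d : R) (x y : X) :=
  exists a b, [/\ pi a = x, pi b = y & near_plane d a b].

Lemma norm_plane_sign m : `|(plane_sign k m)%:~R : R| = 1.
Proof. by rewrite plane_signE rmorph_sign normr_sign. Qed.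

(** The orbit maps are isometries for the sup norm, so the lift of [x] can be prescribed. This is
    what makes the triangle inequality work. *)
Lemma nearby_lift d x y a : nearby d x y -> pi a = x ->
  exists2 b, pi b = y & near_plane d a b.
Proof.
case=> a' [b' [<- <- [h1 h2]]] /esym /proj_planeP[m [n [e1 e2]]].
exists (b'.1 + m%:~R, (plane_sign k m)%:~R * b'.2 + n%:~R).
  by apply/esym/proj_planeP; exists m, n.
split => /=; first by rewrite e1 opprD addrACA subrr addr0.
by rewrite e2 opprD addrACA subrr addr0 -mulrBr normrM norm_plane_sign mul1r.
Qed.

Lemma nearby_sym d x y : nearby d x y -> nearby d y x.
Proof. by case=> a [b [? ? ?]]; exists b, a; split=> //; apply: near_plane_sym. Qed.

Lemma nearby_trans d d' x y z : nearby d x y -> nearby d' y z -> nearby (d + d') x z.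
Proof.
case=> a [b [ax bY h]] h'; have [c cz h2] := nearby_lift h' bY.
by exists a, c; split=> //; apply: near_plane_trans h h2.
Qed.

Lemma nearby_le d d' x y : d <= d' -> nearby d x y -> nearby d' x y.
Proof.
by move=> dd' [a [b [ax bY [h1 h2]]]]; exists a, b; split=> //;
  split; apply: lt_le_trans dd'.
Qed.

Lemma nearby_refl d x : 0 < d -> nearby d x x.
Proof.
by move=> d0; have [a ax] := proj_plane_surj x; exists a, a; split=> //;
  split; rewrite subrr normr0.
Qed.

Lemma nearby_open d x : 0 < d -> open [set y | nearby d x y].
Proof.
move=> d0; rewrite /open /= /quotient_open.
have [a ax] := proj_plane_surj x.
rewrite openE => b /= hb.
have [b' b'a h] := nearby_lift (nearby_sym hb) (erefl (pi b)).
case: h => h1 h2.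
pose r := Num.min (d - `|b.1 - b'.1|) (d - `|b.2 - b'.2|).
have r0 : 0 < r by rewrite lt_min !subr_gt0 h1 h2.
rewrite /interior /=.
exists (ball b.1 r, ball b.2 r); first by split; apply: nbhsx_ballx.
move=> c /= [c1 c2]; exists b', c; split => //.
move: c1 c2; rewrite -!ball_normE /= !lt_min => /andP[c1 _] /andP[_ c2].
split; rewrite distrC.
  by rewrite (le_lt_trans (ler_distD b.1 _ _))// distrC -ltrBrDr.
by rewrite (le_lt_trans (ler_distD b.2 _ _))// distrC -ltrBrDr.
Qed.

Lemma near_int (x : R) :
  (forall d, 0 < d -> exists m : int, `|x - m%:~R| < d) ->
  exists m : int, x = m%:~R.
Proof.
move=> h; exists (Num.floor x).
have /andP[fl fu] := floor_itv x.
have [/eqP|neq] := eqVneq (x - (Num.floor x)%:~R) 0; first by rewrite subr_eq0 => /eqP.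
have fpos : 0 < x - (Num.floor x)%:~R by rewrite lt_def neq subr_ge0.
pose d := Num.min (x - (Num.floor x)%:~R) ((Num.floor x + 1)%:~R - x).
have [|m] := h d; first by rewrite lt_min fpos subr_gt0.
rewrite lt_min => /andP[]; rewrite !ltr_norml => /andP[a1 a2] /andP[a3 a4].
have h1 : (Num.floor x)%:~R < m%:~R :> R by move: a1 a2 a3 a4; lra.
have h2 : m%:~R < (Num.floor x + 1)%:~R :> R by move: a1 a2 a3 a4; lra.
by move: h1 h2; rewrite !ltr_int; lia.
Qed.

Lemma nearby_eq x y : (forall d, 0 < d -> nearby d x y) -> x = y.
Proof.
move=> h; have [a ax] := proj_plane_surj x; have [b bY] := proj_plane_surj y.
have H d : 0 < d -> exists m n : int, `|a.1 - b.1 - m%:~R| < d /\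
    `|a.2 - (plane_sign k m)%:~R * b.2 - n%:~R| < d.
  move=> d0; have [c cy [h1 h2]] := nearby_lift (h d d0) ax.
  have /proj_planeP[m [n [e1 e2]]] : pi b = pi c by rewrite cy.
  by exists m, n; rewrite -!addrA -!opprD -e1 -e2.
have [m em] : exists m : int, a.1 - b.1 = m%:~R.
  by apply: near_int => d /H[m [_ [? _]]]; exists m.
have [n en] : exists n : int, a.2 - (plane_sign k m)%:~R * b.2 = n%:~R.
  apply: near_int => d d0.
  have [|m' [n [h1 h2]]] := H (Num.min d 1); first by rewrite lt_min d0 ltr01.
  (* Below distance 1 the integer shift of the first coordinate is unique, which fixes the sign in
     the second one. *)
  have mm : m' = m.
    move: h1; rewrite em -intrB lt_min => /andP[_].
    by rewrite -intr_norm -[1]/(1%:~R) ltr_int; lia.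
  by exists n; move: h2; rewrite mm lt_min => /andP[].
rewrite -ax -bY; apply/esym/proj_planeP; exists m, n.
by rewrite -em -en; split; rewrite addrC subrK.
Qed.

Lemma not_nearby x y : x <> y -> exists2 d, 0 < d & ~ nearby d x y.
Proof.
move=> xy; apply/not_exists2P => h; apply: xy; apply: nearby_eq => d d0.
by have [|/contrapT] := h d.
Qed.

Lemma nearby_nbhs d x : 0 < d -> nbhs x [set y | nearby d x y].
Proof. by move=> d0; apply: open_nbhs_nbhs; split; [exact: nearby_open|exact: nearby_refl]. Qed.

End Closeness.

(** * Positive distances and fine subdivisions by compactness *)

Section Compactness.
Local Open Scope classical_set_scope.
Local Open Scope quotient_scope.
Variables (R : realType) (k : bool).
Let X : topologicalType := quotient_topology {eq_quot (plane_equiv R k)}.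

Lemma not_nearby_near (x y : X) : x <> y ->
  \forall x' \near x & d \near 0^'+, ~ nearby (d : R) x' y.
Proof.
move=> /not_nearby[d d0 nc].
exists ([set x' | nearby (d / 2) x x'], [set d' | d' < d / 2]).
  split; first by apply: nearby_nbhs; rewrite divr_gt0.
  by apply: nbhs_right_lt; rewrite divr_gt0.
move=> [x' d'] /= [h1 h2] h; apply: nc.
apply: (nearby_le _ (nearby_trans h1 h)).
by rewrite [leRHS](splitr d) lerD2l ltW.
Qed.

(** Compactness of [K] separates it from each point of [L], and compactness of [L] makes the
    distance uniform; halving the distance extends it from a point to a neighborhood. *)
Lemma compact_not_nearby (K L : set X) : compact K -> compact L ->
  (forall x, K x -> L x -> False) ->
  exists2 d : R, 0 < d & forall x y, K x -> L y -> ~ nearby d x y.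
Proof.
move=> /compact_near_coveringP cK /compact_near_coveringP cL disj.
have far y : L y -> exists2 d : R, 0 < d & forall x, K x -> ~ nearby d x y.
  move=> Ly.
  have H : \forall d \near (0 : R)^'+, K `<=` [set x | ~ nearby d x y].
    apply: cK => x Kx; apply: not_nearby_near => xy.
    by apply: (disj x) => //; rewrite xy.
  by near (0 : R)^'+ => d; exists d => //; near: d.
have H : \forall d \near (0 : R)^'+,
    L `<=` [set y | forall x, K x -> ~ nearby d x y].
  apply: cL => y Ly; have [d d0 fd] := far y Ly.
  exists ([set y' | nearby (d / 2) y y'], [set d' | d' < d / 2]).
    split; first by apply: nearby_nbhs; rewrite divr_gt0.
    by apply: nbhs_right_lt; rewrite divr_gt0.
  move=> [y' d'] /= [h1 h2] x Kx h; apply: (fd x Kx).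
  apply: (nearby_le _ (nearby_trans h (nearby_sym h1))).
  by rewrite [leRHS](splitr d) lerD2r ltW.
near (0 : R)^'+ => d; exists d => // x y Kx Ly.
have : L `<=` [set y | forall x, K x -> ~ nearby d x y] by near: d.
by move=> /(_ y Ly x Kx).
Unshelve. all: by end_near. Qed.

Lemma arc_compact (A : set X) x y : is_arc R A x y -> compact A.
Proof.
case=> g [gc _ _ _ ->]; apply: continuous_compact => //.
exact: segment_compact.
Qed.

(** Uniform continuity of the parametrization, sampled at multiples of 1 / N. *)
Lemma arc_chain (A : set X) x y (d : R) : is_arc R A x y -> 0 < d ->
  exists N (s : nat -> X), [/\ s 0%N = x, s N = y,
    forall i, (i <= N)%N -> A (s i) &
    forall i, (i < N)%N -> nearby d (s i) (s i.+1)].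
Proof.
case=> g [/subspace_continuousP gc _ g0 g1 ->] d0.
have H : \forall h \near (0 : R)^'+, `[0, 1] `<=` [set s : R | forall s',
    `[0, 1] s -> `[0, 1] s' -> `|s - s'| < h -> nearby d (g s) (g s')].
  apply: (iffLR (compact_near_coveringP _) (@segment_compact R 0 1)) => s s01.
  have d2 : 0 < d / 2 by rewrite divr_gt0.
  have := gc s s01 _ (@nearby_nbhs R k _ (g s) d2).
  rewrite /= /within /= => /nbhs_ballP[r /= r0 rP].
  have {}rP s' : `[0, 1] s' -> `|s - s'| < r -> nearby (d / 2) (g s) (g s').
    by move=> s'01 ss'; apply: rP => //; rewrite -ball_normE.
  have r2 : 0 < r / 2 by rewrite divr_gt0.
  exists (ball s (r / 2), [set h | h < r / 2]).
    by split; [exact: nbhsx_ballx|exact: nbhs_right_lt].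
  move=> [t h] /= []; rewrite -ball_normE /= => st hr t' t01 t'01 tt'.
  rewrite (splitr d); apply: (@nearby_trans _ _ _ _ _ (g s)).
    apply: nearby_sym; apply: rP => //; apply: (lt_trans st).
    by rewrite ltr_pdivrMr// ltr_pMr// ltr1n.
  apply: rP => //; rewrite (splitr r) (le_lt_trans (ler_distD t _ _))// ltrD//.
  exact: lt_trans hr.
near (0 : R)^'+ => h.
have h0 : 0 < h by [].
have hP s s' : `[0, 1] s -> `[0, 1] s' -> `|s - s'| < h -> nearby d (g s) (g s').
  move=> s01; have : `[0, 1] `<=` [set s : R | forall s',
    `[0, 1] s -> `[0, 1] s' -> `|s - s'| < h -> nearby d (g s) (g s')] by near: h.
  by move=> /(_ s s01 s'); apply.
pose N := (Num.truncn h^-1).+1.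
have N0 : (0 < N%:R :> R) by rewrite ltr0n.
have Nh : N%:R^-1 < h by rewrite invf_plt ?posrE// truncnS_gt.
have i01 i : (i <= N)%N -> `[0, 1] (i%:R / N%:R : R).
  move=> iN; rewrite /= in_itv /= divr_ge0 ?ler0n//=.
  by rewrite ler_pdivrMr// mul1r ler_nat.
exists N, (fun i => g (i%:R / N%:R)); split.
- by rewrite mul0r.
- by rewrite divff// gt_eqF.
- by move=> i iN; exists (i%:R / N%:R) => //; apply: i01.
- move=> i iN; apply: hP; [exact/i01/ltnW|exact: i01|].
  by rewrite -mulrBl -natr1 opprD addrA subrr sub0r mulN1r normrN gtr0_norm ?invr_gt0.
Unshelve. all: by end_near. Qed.
End Compactness.

(** * Grids on the torus and the Klein bottle *)

Lemma Zp_intr_eq (n : nat) (a b : int) : (1 < n)%N ->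
  a%:~R = b%:~R :> 'Z_n -> exists m : int, b = a + n%:Z * m.
Proof.
move=> n1 ab; have : (b - a)%:~R = 0 :> 'Z_n by rewrite intrB ab subrr.
have h (c : nat) : c%:R = 0 :> 'Z_n -> exists m : int, c%:Z = n%:Z * m.
  move=> /(congr1 val) /=; rewrite val_Zp_nat// => /eqP /dvdnP[q ->].
  by exists q%:Z; rewrite mulrC PoszM.
case bac: (b - a) => [c|c].
  by move=> /h[m mc]; exists m; rewrite -mc -bac addrC subrK.
rewrite NegzE mulrNz => /eqP; rewrite oppr_eq0 => /eqP /h[m mc].
by exists (- m); rewrite mulrN -mc -NegzE -bac addrC subrK.
Qed.

Lemma Zp_shift_invariant n (P : pred 'Z_n) : (forall x, P (x + 1) = P x) -> forall x y, P x = P y.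
Proof.
move=> Ps; suff h0 x : P x = P 0 by move=> x y; rewrite !h0.
rewrite -(natr_Zp x); elim: (nat_of_ord x) => [|m IH]; first by rewrite mulr0n.
by rewrite -natr1 Ps.
Qed.

Section Lattice.
Variables (k : bool) (h : nat).
Local Notation n := h.*2.+3.
Let Y : finType := ('Z_n * 'Z_n)%type.

(** Instead of one seam with a flip, the Klein grid flips at every step [E]. The side n is odd, so a
    full turn amounts to one flip, and the grid looks the same everywhere. The sign in [node]
    converts plane coordinates into these alternating ones. *)
Definition node (a b : int) : Y := (a%:~R, (plane_sign k a * b)%:~R).
Definition stepE (y : Y) : Y := (y.1 + 1, if k then - y.2 else y.2).
Definition stepN (y : Y) : Y := (y.1, y.2 + 1).
(** Across a flip the right side of the square [y] runs upwards from [E (N y)] to [E y], so the next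
    square is based at the former. *)
Definition stepT (y : Y) : Y := (y.1 + 1, if k then - y.2 - 1 else y.2).

Local Notation adj := (grid_adj stepE stepN).

Lemma lattice_grid : quad_grid stepE stepN stepT.
Proof.
have trans (f : Y -> Y) : (forall y, (f y).1 = y.1 + 1) -> jointly_transitive f stepN.
  move=> f1 P Pf PN.
  have col i j j' : P (i, j) = P (i, j').
    by apply: (Zp_shift_invariant (P := fun j => P (i, j))) => x; rewrite -[RHS]PN.
  have row i i' j : P (i, j) = P (i', j).
    apply: (Zp_shift_invariant (P := fun i => P (i, j))) => x.
    rewrite -[RHS]Pf; have -> : f (x, j) = (x + 1, (f (x, j)).2).
      by rewrite [LHS]surjective_pairing f1.
    exact: col.
  by move=> [i j] [i' j']; rewrite (col i j j') (row i i').
split.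
- by move=> [i j] [i' j'] /pair_equal_spec /= [-> /addIr ->].
- move=> [i j] [i' j'] /pair_equal_spec /= [/addIr ->].
  by case: k => [/addIr /oppr_inj|] ->.
- exact: trans.
- exact: trans.
- move=> [i j]; rewrite /stepT /stepE /stepN /=; case: k; last by left.
  by right; rewrite subrK opprD.
Qed.

Lemma plane_sign1 : plane_sign k 1 = if k then -1 else 1.
Proof. by rewrite /plane_sign; case: k. Qed.

Lemma node_adjE a b : adj (node a b) (node (a + 1) b).
Proof.
apply/orP; left; rewrite /node /stepE /= plane_signD plane_sign1 intrD.
by case: k; rewrite ?mulr1 // mulrN1 mulNr mulrNz.
Qed.

Lemma plane_sign_cases a : plane_sign k a = 1 \/ plane_sign k a = -1.
Proof. by rewrite plane_signE; case: (_ && _); [right|left]. Qed.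

Lemma node_adjN a b : adj (node a b) (node a (b + 1)).
Proof.
rewrite /grid_adj /node /stepN /=.
case: (plane_sign_cases a) => ->.
  by rewrite !mul1r intrD eqxx orbT.
by rewrite !mulN1r opprD !intrD !mulrNz subrK eqxx !orbT.
Qed.

(** The path moves horizontally, then vertically, and stays in the box spanned by its ends. *)
Lemma node_connect (P : pred Y) a b a' b' :
  (forall c d, Num.min a a' <= c <= Num.max a a' ->
     Num.min b b' <= d <= Num.max b b' -> P (node c d)) ->
  connect (rel_in adj P) (node a b) (node a' b').
Proof.
have csym := sym_connect_sym (rel_in_sym P (@grid_adj_sym _ stepE stepN)).
have row (m : nat) c d : (forall j : nat, (j <= m)%N -> P (node (c + j%:Z) d)) ->
    connect (rel_in adj P) (node c d) (node (c + m%:Z) d).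
  elim: m => [|m IH] Pm; first by rewrite addr0.
  apply: (connect_trans (IH _)) => [j jm|]; first by apply: Pm; apply: leqW.
  apply: connect1; rewrite /rel_in !Pm //= !andbT -addn1 PoszD addrA.
  exact: node_adjE.
have col (m : nat) c d : (forall j : nat, (j <= m)%N -> P (node c (d + j%:Z))) ->
    connect (rel_in adj P) (node c d) (node c (d + m%:Z)).
  elim: m => [|m IH] Pm; first by rewrite addr0.
  apply: (connect_trans (IH _)) => [j jm|]; first by apply: Pm; apply: leqW.
  apply: connect1; rewrite /rel_in !Pm //= !andbT -addn1 PoszD addrA.
  exact: node_adjN.
move=> Pb; apply: (@connect_trans _ _ (node a' b)).
  have [aa'|aa'] := leP a a'.
    have -> : a' = a + `|a' - a|%N%:Z by lia.
    by apply: row => j jm; apply: Pb; lia.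
  rewrite csym; have -> : a = a' + `|a - a'|%N%:Z by lia.
  by apply: row => j jm; apply: Pb; lia.
have [bb'|bb'] := leP b b'.
  have -> : b' = b + `|b' - b|%N%:Z by lia.
  by apply: col => j jm; apply: Pb; lia.
rewrite csym; have -> : b = b' + `|b - b'|%N%:Z by lia.
by apply: col => j jm; apply: Pb; lia.
Qed.

Section Points.
Variable R : realType.

Definition node_point (a b : int) := proj_plane k (a%:~R / n%:R : R, b%:~R / n%:R).

Lemma node_point_eq a b a' b' : node a b = node a' b' ->
  node_point a b = node_point a' b'.
Proof.
move=> [/(Zp_intr_eq (isT : 1 < n)%N) [m am] /(Zp_intr_eq (isT : 1 < n)%N) [l bl]].
have n0 : n%:R != 0 :> R by rewrite pnatr_eq0.
have sgn2 c : plane_sign k c * plane_sign k c = 1.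
  by case: (plane_sign_cases c) => ->; rewrite ?mulr1 ?mulrNN ?mulr1.
have sgnn : plane_sign k (n%:Z * m) = plane_sign k m.
  by rewrite !plane_signE abszM oddM /= odd_double.
have bE : b' = plane_sign k m * b + n%:Z * (plane_sign k a' * l).
  rewrite -[LHS]mul1r -(sgn2 a') -mulrA bl mulrDr mulrA mulrCA; congr (_ * b + _).
  by rewrite am plane_signD sgnn mulrAC sgn2 mul1r.
apply/proj_planeP; exists m, (plane_sign k a' * l); split => /=.
  by rewrite am intrD intrM mulrDl mulrAC -pmulrn mulfV// mul1r.
rewrite {1}bE intrD !intrM mulrDl -!mulrA; congr (_ + _).
by rewrite mulrC -!mulrA -pmulrn mulVf // mulr1.
Qed.

End Points.
End Lattice.

Lemma connect_rel_in_sub (T : finType) (r : rel T) (P Q : pred T) x y :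
  (forall z, connect (rel_in r P) x z -> Q z) ->
  connect (rel_in r P) x y -> connect (rel_in r Q) x y.
Proof.
move=> PQ /connectP[s]; elim/last_ind: s y => [|s z IH] y.
  by move=> _ ->; apply: connect0.
rewrite rcons_path last_rcons => /andP[ps rz] ->.
have cl : connect (rel_in r P) x (last x s) by apply/connectP; exists s.
apply: (connect_trans (IH _ ps erefl)); apply: connect1.
rewrite /rel_in !PQ ?(andP rz).1//.
exact: connect_trans cl (connect1 rz).
Qed.

(** The path is cut at its first vertex in [B]. *)
Lemma connect_exit (T : finType) (r : rel T) (P B : pred T) x y :
  connect (rel_in r P) x y -> ~~ B x -> B y ->
  exists z z', [/\ connect (rel_in r (fun z => P z && ~~ B z)) x z, B z' & r z z'].
Proof.
move=> /connectP[s]; elim: s x => [|z s IH] x /=.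
  by move=> _ -> /negP.
move=> /andP[rxz ps] yl nBx By; have [Bz|nBz] := boolP (B z).
  by exists x, z; split; rewrite ?connect0//; case/and3P: rxz.
have [a [b [cza Bb ab]]] := IH z ps yl nBz By.
exists a, b; split=> //; apply: connect_trans cza; apply: connect1.
by case/and3P: rxz => rxz Px Pz; rewrite /rel_in rxz Px Pz nBx nBz.
Qed.

Lemma common_radius (R : realType) (I : finType) (P : I -> R -> Prop) :
  (forall i, exists2 d, 0 < d & P i d) ->
  (forall i d d', d' <= d -> P i d -> P i d') ->
  exists2 d, 0 < d & forall i, P i d.
Proof.
move=> ex mono; have [f fP] : {f : I -> R & forall i, 0 < f i /\ P i (f i)}.
  apply: (@boolp.choice _ _ (fun i d => 0 < d /\ P i d)) => i.
  by have [d d0 Pd] := ex i; exists d.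
exists (\big[Num.min/1]_i f i).
  by apply: lt_bigmin => // i _; case: (fP i).
move=> i; apply: (mono i (f i)); last by case: (fP i).
exact: bigmin_le_cond.
Qed.

(** * Grid versions of points and arcs *)

Section Minor.
Local Open Scope quotient_scope.
Local Open Scope classical_set_scope.
Variables (R : realType) (k : bool).
Let X : topologicalType := quotient_topology {eq_quot (plane_equiv R k)}.

Section Mesh.
Variable h : nat.
Local Notation n := h.*2.+3.
Local Notation node := (node k h).
Local Notation node_point := (node_point k h R).
Local Notation adj := (grid_adj (@stepE k h) (@stepN h)).
Let n_gt0 : 0 < n%:R :> R. Proof. by rewrite ltr0n. Qed.

Lemma node_lift a b c : proj_plane k c = node_point a b ->
  exists a' b', c = (a'%:~R / n%:R, b'%:~R / n%:R) /\ node a' b' = node a b.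
Proof.
move=> /esym /proj_planeP /= [m [l [c1 c2]]].
exists (a + n%:Z * m), (plane_sign k m * b + n%:Z * l); split.
  rewrite [LHS]surjective_pairing c1 c2; congr pair.
    by rewrite intrD intrM mulrDl mulrAC -pmulrn mulfV ?gt_eqF// mul1r.
  by rewrite intrD !intrM -pmulrn mulrDl -!mulrA [n%:R * _]mulrC -mulrA mulVf ?gt_eqF// mulr1.
have nZ : n%:~R = 0 :> 'Z_n by rewrite -pmulrn pchar_Zp.
rewrite /node; congr pair; first by rewrite intrD intrM nZ mul0r addr0.
rewrite plane_signD mulrDr !intrD !intrM nZ mul0r mulr0 addr0 mulrA -!intrM.
have -> : plane_sign k (n%:Z * m) = plane_sign k m.
  by rewrite !plane_signE abszM oddM /= odd_double.
by case: (plane_sign_cases k m) => ->; rewrite ?mulr1 // !mulrN1 opprK.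
Qed.

Definition vblob (d : R) (x : X) : pred ('Z_n * 'Z_n) := fun y =>
  `[< exists a b, y = node a b /\ nearby d x (node_point a b) >].

Definition vtube (d : R) (A : set X) : pred ('Z_n * 'Z_n) := fun y =>
  `[< exists a b x, [/\ y = node a b, A x & nearby d x (node_point a b)] >].

Lemma vblob_nearby d d' x x' y : vblob d x y -> vblob d' x' y -> nearby (d + d') x x'.
Proof.
move=> /asboolP[a [b [-> h1]]] /asboolP[a' [b' [yE h2]]].
by apply: nearby_trans h1 _; rewrite (node_point_eq _ yE); apply: nearby_sym.
Qed.

Lemma vtube_blob d A y : vtube d A y -> exists2 x, A x & vblob d x y.
Proof.
by move=> /asboolP[a [b [x [-> Ax hx]]]]; exists x => //; apply/asboolP; exists a, b.
Qed.

Lemma between_near (d x a b c : R) : `|a - x| < d -> `|b - x| < d ->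
  Num.min a b <= c <= Num.max a b -> `|c - x| < d.
Proof. by rewrite !ltr_norml; case: (leP a b); lra. Qed.

Lemma node_coord_between (a b c : int) : Num.min a b <= c <= Num.max a b ->
  Num.min (a%:~R / n%:R) (b%:~R / n%:R) <= (c%:~R / n%:R : R) <=
    Num.max (a%:~R / n%:R) (b%:~R / n%:R).
Proof.
rewrite !(le_min, le_max, ge_min, ge_max) !ler_pM2r ?invr_gt0// !ler_int.
by move=> /andP[-> ->].
Qed.

(** Seen from one lift [q] of [x], all nodes of the blob are lattice points of a square around [q],
    which contains the box spanned by any two of them. *)
Lemma vblob_connect d x y y' : vblob d x y -> vblob d x y' ->
  connect (rel_in adj (vblob d x)) y y'.
Proof.
have [q qx] := proj_plane_surj x.
have H z : vblob d x z -> exists a b, z = node a b /\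
    near_plane d q (a%:~R / n%:R, b%:~R / n%:R).
  move=> /asboolP[a [b [-> hz]]]; have [c ce qc] := nearby_lift hz qx.
  by have [a' [b' [cE nE]]] := node_lift ce; exists a', b'; rewrite -cE nE.
move=> /H[a [b [-> [/= h1 h2]]]] /H[a' [b' [-> [/= h1' h2']]]].
apply: node_connect => c e hc he; apply/asboolP; exists c, e; split=> //.
exists q, (c%:~R / n%:R, e%:~R / n%:R); split=> //; split => /=.
  rewrite distrC; apply: between_near (node_coord_between hc); by rewrite distrC.
rewrite distrC; apply: between_near (node_coord_between he); by rewrite distrC.
Qed.

Definition round_node (q : R * R) := node (Num.floor (q.1 * n%:R)) (Num.floor (q.2 * n%:R)).

Lemma round_coord (x : R) : exists t : R,
  (Num.floor (x * n%:R))%:~R / n%:R = x - t /\ 0 <= t < n%:R^-1.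
Proof.
have /andP[fl fu] := floor_itv (x * n%:R).
exists (x - (Num.floor (x * n%:R))%:~R / n%:R); split.
  by rewrite opprD opprK addrA subrr add0r.
rewrite subr_ge0 ler_pdivrMr// fl /= -(ltr_pM2r n_gt0) mulrBl mulrVK ?unitf_gt0//.
rewrite mulVr ?unitf_gt0// ltrBlDl; move: fu; rewrite intrD; exact.
Qed.

Lemma round_node_blob d q : n%:R^-1 <= d -> vblob d (proj_plane k q) (round_node q).
Proof.
move=> nd; apply/asboolP; eexists; eexists; split; first reflexivity.
exists q; eexists; split; [by []|reflexivity|].
have [t1 [e1 /andP[a1 b1]]] := round_coord q.1.
have [t2 [e2 /andP[a2 b2]]] := round_coord q.2.
split => /=; rewrite ?e1 ?e2 opprD addrA subrr sub0r opprK ger0_norm//.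
  exact: lt_le_trans nd.
exact: lt_le_trans nd.
Qed.

Lemma round_step d d' A q q' : near_plane d q q' -> d + n%:R^-1 <= d' ->
  A (proj_plane k q) -> connect (rel_in adj (vtube d' A)) (round_node q) (round_node q').
Proof.
move=> [h1 h2] dd' Aq; apply: node_connect => a b ha hb.
apply/asboolP; exists a, b, (proj_plane k q); split=> //.
exists q, (a%:~R / n%:R, b%:~R / n%:R); split=> //.
have aux (x x' : R) c : `|x - x'| < d ->
    Num.min (Num.floor (x * n%:R)) (Num.floor (x' * n%:R)) <= c <=
    Num.max (Num.floor (x * n%:R)) (Num.floor (x' * n%:R)) ->
    `|x - c%:~R / n%:R| < d'.
  move=> xx' /node_coord_between.
  have [t1 [-> /andP[a1 b1]]] := round_coord x.
  have [t2 [-> /andP[a2 b2]]] := round_coord x'.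
  move: (c%:~R / n%:R) => w hc; rewrite distrC; move: dd' b1 b2; move: n%:R^-1 => z dd' b1 b2.
  move: xx'; rewrite ltr_norml => /andP[? ?].
  by apply: (between_near _ _ hc); rewrite ltr_norml; apply/andP; split; lra.
by split; [exact: aux h1 ha|exact: aux h2 hb].
Qed.

(** The arc is lifted in steps below d / 2; with a rounding error below 1 / n, all nodes stay within
    d. The end [q'] is whichever lift of [y] is reached. *)
Lemma arc_tube d A x y q : is_arc R A x y -> proj_plane k q = x ->
  0 < d -> 2 / n%:R <= d ->
  exists2 q', proj_plane k q' = y &
    connect (rel_in adj (vtube d A)) (round_node q) (round_node q').
Proof.
move=> arcA qx d0 nd; have d2 : 0 < d / 2 by rewrite divr_gt0.
have [N [s [s0 sN sA sstep]]] := arc_chain arcA d2.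
suff H i : (i <= N)%N -> exists2 q', proj_plane k q' = s i &
    connect (rel_in adj (vtube d A)) (round_node q) (round_node q').
  by have [q' q'y cq] := H N (leqnn N); exists q'; rewrite // q'y sN.
elim: i => [|i IH] iN; first by exists q; rewrite ?s0 ?connect0.
have [q1 q1i c1] := IH (ltnW iN); have [q2 q2i near12] := nearby_lift (sstep i iN) q1i.
exists q2 => //; apply: connect_trans c1 _; apply: round_step near12 _ _.
  by rewrite [leRHS](splitr d) lerD2l; rewrite ler_pdivlMr// mulrC.
by rewrite q1i; apply: sA; apply: ltnW.
Qed.

End Mesh.
End Minor.

(** * From embeddings to grid minors *)

Section Embedding.
Local Open Scope quotient_scope.
Local Open Scope classical_set_scope.
Variables (R : realType) (k : bool).
Let X : topologicalType := quotient_topology {eq_quot (plane_equiv R k)}.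

(** Arcs sharing an end are not at positive distance; their middle parts, with small discs around
    the vertices cut out, are. Hence the scales: [r] for the discs, [rk] for the distance of middle
    parts, and a tube radius [d] small against both, so that tubes of different edges meet only in
    blobs around vertices. *)
Lemma embeddable_grid_minor (V : finType) (e : rel V) : symmetric e -> irreflexive e ->
  embeddable R X e -> grid_minor e.
Proof.
move=> e_sym e_irr [p [A [p_inj A_arc A_ends A_disj]]].
have [r4 r40 rsep] : exists2 d : R, 0 < d &
    forall i : V * V, i.1 <> i.2 -> ~ nearby d (p i.1) (p i.2).
  apply: common_radius => [[u w]|[u w] d d' dd' /= h uw uw'].
    have [->|uw] := eqVneq u w; first by exists 1.
    have [|d d0 nd] := @not_nearby R k (p u) (p w); last by exists d.
    by move=> /p_inj /eqP; apply/negP.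
  exact: h uw (nearby_le dd' uw').
have [ra ra0 rarc] : exists2 d : R, 0 < d & forall i : V * V * V,
    e i.1.1 i.1.2 -> i.2 <> i.1.1 -> i.2 <> i.1.2 ->
    forall y, A [set i.1.1; i.1.2]%SET y -> ~ nearby d (p i.2) y.
  apply: common_radius => [[[u v] w]|i d d' dd' h euv wu wv y Ay yw] /=; last first.
    exact: (h euv wu wv y Ay (nearby_le dd' yw)).
  have [euv|neuv] := boolP (e u v); last by exists 1.
  have [->|wu] := eqVneq w u; first by exists 1.
  have [->|wv] := eqVneq w v; first by exists 1.
  have [|d d0 dP] := compact_not_nearby (@compact_set1 X (p w)) (arc_compact (A_arc _ _ euv)).
    by move=> x -> /(A_ends _ _ _ euv) []; apply/eqP.
  by exists d => // _ _ _ y Ay; apply: dP.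
(* Two blobs of radius [r + d], with [d <= r], span at most [4 r]. *)
pose r : R := Num.min r4 ra / 4.
have r0 : 0 < r by rewrite divr_gt0// lt_min r40.
have rE : r + r + (r + r) = Num.min r4 ra by rewrite /r; field.
have {r40} rsep u w d : d <= r + r + (r + r) -> nearby d (p u) (p w) -> u = w.
  rewrite rE le_min => /andP[d4 _] h; apply: contrapT => uw.
  exact: (rsep (u, w) uw (nearby_le d4 h)).
have {ra0} rarc u v w y d : e u v -> A [set u; v]%SET y -> d <= r + r + (r + r) ->
    nearby d (p w) y -> w = u \/ w = v.
  move=> euv Ay; rewrite rE le_min => /andP[_ da] h.
  apply: contrapT => /not_orP[wu wv].
  exact: (rarc (u, v, w) euv wu wv y Ay (nearby_le da h)).
pose K u v := A [set u; v]%SET `&` [set y | forall w, ~ nearby r (p w) y].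
have K_compact u v : e u v -> compact (K u v).
  move=> euv; apply: compact_closedI; first exact: arc_compact (A_arc _ _ euv).
  have -> : [set y | forall w, ~ nearby r (p w) y] =
      \bigcap_(w in [set: V]) ~` [set y | nearby r (p w) y].
    by apply/seteqP; split=> y /= h w; [move=> _|]; apply: h.
  by apply: closed_bigI => w _; apply: open_closedC; apply: nearby_open.
have [rk rk0 rK] : exists2 d : R, 0 < d & forall i : (V * V) * (V * V),
    e i.1.1 i.1.2 -> e i.2.1 i.2.2 ->
    [set i.1.1; i.1.2]%SET != [set i.2.1; i.2.2]%SET ->
    forall a b, K i.1.1 i.1.2 a -> K i.2.1 i.2.2 b -> ~ nearby d a b.
  apply: common_radius => [[[u v] [x y]]|i d d' dd' h e1 e2 ne a b Ka Kb ab] /=;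
      last first.
    exact: (h e1 e2 ne a b Ka Kb (nearby_le dd' ab)).
  have [euv|neuv] := boolP (e u v); last by exists 1.
  have [exy|nexy] := boolP (e x y); last by exists 1.
  have [uvxy|ne] := eqVneq [set u; v]%SET [set x; y]%SET.
    by exists 1 => // _ _ /eqP ne; case: (ne uvxy).
  have [|d d0 dP] := compact_not_nearby (K_compact _ _ euv) (K_compact _ _ exy).
    move=> a [Aa Ka] [Aa' _]; have [w _ wa] := A_disj _ _ _ _ euv exy ne a (conj Aa Aa').
    by apply: (Ka w); rewrite wa; apply: nearby_refl.
  by exists d => // _ _ _ a b Ka Kb; apply: dP.
pose d : R := Num.min r (rk / 2).
have d0 : 0 < d by rewrite lt_min r0 divr_gt0.
have dr : d <= r by rewrite ge_min lexx.
have dk : d + d <= rk by rewrite [leRHS]splitr lerD// ge_min lexx orbT.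
pose h := Num.truncn (2 / d).
have hd : 2 / h.*2.+3%:R <= d.
  rewrite ler_pdivrMr// mulrC -ler_pdivrMr//.
  apply: (le_trans (ltW (truncnS_gt _))); rewrite ler_nat -/h; lia.
have hd1 : h.*2.+3%:R^-1 <= d.
  by apply: le_trans hd; rewrite ler_peMl ?invr_ge0// ler1n.
pose adj := grid_adj (@stepE k h) (@stepN h).
(* The radius is [r + d] so that a node within [d] of a point of an arc that is within [r] of [p v]
   belongs to the blob. *)
pose B v : pred ('Z_(h.*2.+3) * 'Z_(h.*2.+3)) := vblob (h := h) (r + d) (p v).
pose P u v := vtube (h := h) d (A [set u; v]%SET).
have pq v : exists q, proj_plane k q = p v by apply: proj_plane_surj.
have [q qP] := boolp.choice pq.
pose c v := round_node k h (q v).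
have cB v : B v (c v).
  by rewrite /B -qP; apply: round_node_blob; rewrite (le_trans hd1)// lerDr ltW.
have B_disj u v y : B u y -> B v y -> u = v.
  move=> uy /(vblob_nearby uy); apply: rsep; rewrite addrACA lerD// lerD//.
have AB u v w y : e u v -> P u v y -> B w y -> w = u \/ w = v.
  move=> euv /vtube_blob[x Ax xy] wy; apply: (rarc _ _ _ _ _ euv Ax _ (vblob_nearby wy xy)).
  by rewrite -addrA lerD ?lerD// ?lerDl ?ltW//; rewrite lerDl ltW.
have split_tube u v y : e u v -> P u v y ->
    [\/ B u y, B v y | exists2 x, K u v x & vblob d x y].
  move=> euv /vtube_blob[x Ax xy].
  have [Kx|] := pselect (K u v x); first by constructor 3; exists x.
  move=> /not_andP[//|/existsNP[w /contrapT wx]].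
  have Bw : B w y.
    by move: xy => /asboolP[a [b [-> hx]]]; apply/asboolP; exists a, b; split=> //;
      apply: nearby_trans hx.
  have [<-|<-] : w = u \/ w = v; [|by constructor 1|by constructor 2].
  apply: (rarc _ _ _ _ _ euv Ax _ wx); rewrite -{1}[r]addr0 -addrA lerD//.
  by rewrite !addr_ge0// ltW.
have KK u v x y z : e u v -> e x y -> [set u; v]%SET != [set x; y]%SET ->
    (exists2 a, K u v a & vblob d a z) -> (exists2 b, K x y b & vblob d b z) -> False.
  move=> euv exy ne [a Ka az] [b Kb bz].
  apply: (rK ((u, v), (x, y)) euv exy ne a b Ka Kb).
  exact: nearby_le dk (vblob_nearby az bz).
(* Taking only what is reached from [c u] makes connectedness automatic. *)
pose W u v := [set y | connect (rel_in adj (fun z => P u v z && ~~ B v z)) (c u) y]%SET.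
have W_split u v y : e u v -> y \in W u v ->
    ~~ B v y /\ (B u y \/ exists2 x, K u v x & vblob d x y).
  move=> euv; rewrite inE => /connectP[s]; case/lastP: s => [_ ->|s z].
    split; last by left.
    apply/negP => /(B_disj _ _ _ (cB u)) uv.
    by move: euv; rewrite uv e_irr.
  rewrite rcons_path last_rcons => /andP[_ /and3P[_ _ /andP[Pz nBz]]] ->.
  split=> //; have [Bu|Bv|Kz] := split_tube u v z euv Pz; first by left.
    by rewrite Bv in nBz.
  by right.
have W_exit u v : e u v -> exists x y, [/\ x \in W u v, B v y & adj x y].
  move=> euv.
  have [q' q'v cq] := arc_tube (A_arc _ _ euv) (qP u) d0 hd.
  have [||z [z' [cz Bz' zz']]] := connect_exit cq (B := B v).
  - by apply/negP => /(B_disj _ _ _ (cB u)) uv; move: euv; rewrite uv e_irr.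
  - by rewrite /B -q'v; apply: round_node_blob; rewrite (le_trans hd1)// lerDr ltW.
  - by exists z, z'; split=> //; rewrite inE.
(* The tube of an edge, up to the blob of its second end, goes to its first end. *)
pose br u := [set y | B u y ||
  [exists v, [&& e u v, (enum_rank u < enum_rank v)%N & y \in W u v]]]%SET.
have brP u y : y \in br u ->
    B u y \/ exists v, [/\ e u v, (enum_rank u < enum_rank v)%N & y \in W u v].
  rewrite inE => /orP[|/existsP[v /and3P[euv uv yW]]]; first by left.
  by right; exists v.
have br_W u v y : e u v -> (enum_rank u < enum_rank v)%N -> y \in W u v -> y \in br u.
  by move=> euv uv yW; rewrite inE; apply/orP; right; apply/existsP; exists v; apply/and3P.
have B_W u v w y : e v w -> y \in W v w -> B u y -> u = v.
  move=> evw /(W_split _ _ _ evw)[nBw [Bv|[x [Ax _] xy]]] Bu; first exact: B_disj Bu Bv.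
  have Pvw : P v w y.
    move: xy => /asboolP[a [b [-> hx]]]; apply/asboolP; exists a, b, x; split=> //.
  have [//|uw] := AB _ _ _ _ evw Pvw Bu.
  by rewrite -uw Bu in nBw.
exists ('Z_(h.*2.+3) * 'Z_(h.*2.+3))%type, (@stepE k h), (@stepN h), (@stepT k h), br.
split.
- exact: lattice_grid.
- move=> u v y /brP[Bu|[w [euw uw yW]]] /brP[Bv|[w' [evw' vw' yW']]].
  + exact: B_disj Bu Bv.
  + exact: B_W evw' yW' Bu.
  + by apply/esym; apply: B_W euw yW Bv.
  + apply: contrapT => nuv.
    have [nBw [Bu|Ku]] := W_split _ _ _ euw yW.
      exact/nuv/(B_W _ _ _ _ evw' yW' Bu).
    have [nBw' [Bv|Kv]] := W_split _ _ _ evw' yW'.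
      exact/nuv/esym/(B_W _ _ _ _ euw yW Bv).
    (* Close middle parts force equal edges; as [u] and [v] differ, they are the two ends, and each
       would have to precede the other in rank. *)
    apply: KK euw evw' _ Ku Kv; apply/eqP => /setP E.
    have := E u; have := E v; rewrite !inE !eqxx /= !(eq_sym v u).
    have -> : (u == v) = false by apply/eqP.
    move=> /= /eqP vw /esym /eqP uw'; move: uw vw'.
    by rewrite -vw -uw' => uv /(ltn_trans uv); rewrite ltnn.
- move=> v.
  have to_c y : y \in br v -> connect (rel_in adj (mem (br v))) (c v) y.
    move=> yb; case: (brP _ _ yb) => [Bv|[w [evw vw yW]]].
      apply: (@connect_rel_in_sub _ adj (B v)); last exact: vblob_connect (cB v) Bv.
      move=> z /connectP[s]; case/lastP: s => [_ ->|s z'].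
        by rewrite /= !inE cB.
      rewrite rcons_path last_rcons => /andP[_ /and3P[_ _ Bz]] ->.
      by rewrite /= !inE Bz.
    have yW' := yW; rewrite inE in yW'.
    apply: connect_rel_in_sub yW' => z cz.
    by apply: br_W evw vw _; rewrite inE.
  move=> x y xb yb; apply: connect_trans (to_c y yb).
  have csym := sym_connect_sym (rel_in_sym (mem (br v)) (@grid_adj_sym _ (@stepE k h) (@stepN h))).
  by rewrite csym; apply: to_c.
- have main u v : e u v -> (enum_rank u < enum_rank v)%N -> exists x y,
      [/\ x \in br u, y \in br v & adj x y].
    move=> euv uv; have [x [y [xW By xy]]] := W_exit u v euv.
    exists x, y; split=> //; last by rewrite !inE By.
    exact: br_W xW.
  move=> u v euv; case: (ltngtP (enum_rank u) (enum_rank v)) => uv.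
  + exact: main.
  + have [x [y [xv yu xy]]] := main v u (etrans (e_sym v u) euv) uv.
    by exists y, x; split=> //; rewrite grid_adj_sym.
  + by move: euv; rewrite (enum_rank_inj (val_inj uv)) e_irr.
Qed.
End Embedding.

Theorem theorem1 (R : realType) (V : finType) (e : rel V)
    (e_sym : symmetric e) (e_irr : irreflexive e)
    (e_emb : embeddable R (torus R) e \/ embeddable R (klein_bottle R) e)
    (no_C3 : ~ has_cycle e 3) (no_C4 : ~ has_cycle e 4)
    (no_C6 : ~ has_cycle e 6)
    (C5_edge_disjoint : forall c1 c2 : seq V,
      is_cycle e 5 c1 -> is_cycle e 5 c2 ->
      cycle_edges c1 <> cycle_edges c2 ->
      [disjoint cycle_edges c1 & cycle_edges c2]) :
  odd_choosable e 5.
Proof.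
apply: minor_odd_choosable => //.
by case: e_emb; apply: embeddable_grid_minor.
Qed.
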